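(* Let $0<\lambda<1/e$ and $f(z)=\lambda e^z$. Then every non-trivial hair of $f$ is not analytic. That is, if $\underline{s}\in\mathbb{Z}^{\mathbb{N}}$ is such that $J_{\underline{s}}\neq\emptyset$ and the hair $J_{\underline{s}}$ is not trivial, then there do not exist $\epsilon>0$ and a non-constant real analytic map $\phi:(-\epsilon,\epsilon)\to\mathbb{C}$ with $\phi((-\epsilon,\epsilon))\subset J_{\underline{s}}$.
   Context: Fix $0<\lambda<1/e$ and $f(z)=\lambda e^z$, and let $f^n$ denote the $n$-th iterate of $f$ ($f^0=\mathrm{id}$). The Fatou set of $f$ is the set of points of $\mathbb{C}$ having a neighbourhood on which $\{f^n\}_{n\ge 0}$ is a normal family; the Julia set $J(f)$ is its complement in $\mathbb{C}$. The map $f$ has an attracting fixed point $\alpha$ and a repelling fixed point $\beta$ on the real axis, with $0<\alpha<1<\beta$. For $k\in\mathbb{Z}$ put $P_k=\{z\in\mathbb{C}: -\pi+2k\pi<\operatorname{Im} z\le \pi+2k\pi\}$. For $z\in J(f)$ the external address of $z$ is the sequence $\underline{s}(z)=(s_0,s_1,s_2,\ldots)\in\mathbb{Z}^{\mathbb{N}}$ determined by $f^n(z)\in P_{s_n}$ for all $n\ge 0$. For $\underline{s}\in\mathbb{Z}^{\mathbb{N}}$ put $J_{\underline{s}}=\{z\in J(f):\underline{s}(z)=\underline{s}\}$. The hairs of $f$ are the non-empty sets $J_{\underline{s}}$; each is a curve joining a finite endpoint to $\infty$, and $J(f)$ is the disjoint union of the hairs. The hair in the real axis is $[\beta,\infty)=J_{(0,0,0,\ldots)}$.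 A hair is called trivial if it is a preimage of the hair in the real axis, i.e. if $f^n(J_{\underline{s}})\subset[\beta,\infty)$ for some $n\ge 0$. A map $\phi:(-\epsilon,\epsilon)\to\mathbb{C}$ is real analytic if near each point of $(-\epsilon,\epsilon)$ it is given by a convergent power series in the real variable with complex coefficients. *)

(* Defs.v *)
(* Stdlib reals and Coquelicot. *)
From Stdlib Require Export Reals ZArith.
From Coquelicot Require Export Coquelicot.
Open Scope R_scope.

Definition Cexp (z : C) : C :=
  (exp (Re z) * cos (Im z), exp (Re z) * sin (Im z)).

Definition fexp (lam : R) (z : C) : C := (RtoC lam * Cexp z)%C.

Definition iter (g : C -> C) (n : nat) (z : C) : C := Nat.iter n g z.

(* The Riemann sphere is [option C], with [None] as the point at infinity. *)
Definition chordal (p q : option C) : R :=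
  match p, q with
  | Some z, Some w =>
      2 * Cmod (z - w)%C / (sqrt (1 + Cmod z ^ 2) * sqrt (1 + Cmod w ^ 2))
  | Some z, None | None, Some z => 2 / sqrt (1 + Cmod z ^ 2)
  | None, None => 0
  end.

(* Local uniform convergence on an open set is the same as uniform
   convergence on its compact subsets, [C] being locally compact. *)
Definition loc_unif_cv (U : C -> Prop) (h : nat -> C -> C)
    (g : C -> option C) : Prop :=
  forall z, U z -> exists V : C -> Prop, open V /\ V z /\
    forall eps, 0 < eps -> exists N : nat, forall n, (N <= n)%nat ->
      forall w, U w -> V w -> chordal (Some (h n w)) (g w) < eps.

(* Normality is with respect to the spherical metric, so that locally uniform
   convergence to infinity is allowed. *)
Definition normal_family {I : Type} (U : C -> Prop) (F : I -> C -> C) : Prop :=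
  forall i : nat -> I, exists k : nat -> nat,
    (forall n, (k n < k (S n))%nat) /\
    exists g : C -> option C, loc_unif_cv U (fun n => F (i (k n))) g.

Definition fatou (g : C -> C) (z : C) : Prop :=
  exists U : C -> Prop, open U /\ U z /\ normal_family U (iter g).

Definition julia (g : C -> C) (z : C) : Prop := ~ fatou g z.

Definition strip (k : Z) (z : C) : Prop :=
  - PI + 2 * IZR k * PI < Im z <= PI + 2 * IZR k * PI.

Definition has_address (lam : R) (z : C) (s : nat -> Z) : Prop :=
  forall n, strip (s n) (iter (fexp lam) n z).

Definition hair (lam : R) (s : nat -> Z) (z : C) : Prop :=
  julia (fexp lam) z /\ has_address lam z s.

(* The derivative is the complex one: [is_derive] is over [C_AbsRing]. *)
Definition repelling_fixed_point (g : C -> C) (z : C) : Prop :=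
  g z = z /\
  exists d : C, @is_derive C_AbsRing C_NormedModule g z d /\ 1 < Cmod d.

(* For 0 < lam < 1/e the repelling real fixed point [beta] exists and is
   unique. *)
Definition trivial_hair (lam : R) (s : nat -> Z) : Prop :=
  exists beta : R, repelling_fixed_point (fexp lam) (RtoC beta) /\
  exists n : nat, forall z, hair lam s z ->
    exists x : R, beta <= x /\ iter (fexp lam) n z = RtoC x.

(* Convergent power series in the real variable [t - t0] with coefficients in
   [C], viewed as a real normed space. *)
Definition real_analytic (a b : R) (phi : R -> C) : Prop :=
  forall t0, a < t0 < b -> exists (c : nat -> C) (r : R), 0 < r /\
    forall t, a < t < b -> Rabs (t - t0) < r ->
      @is_pseries R_AbsRing C_R_NormedModule c (t - t0) (phi t).

Definition non_constant (a b : R) (phi : R -> C) : Prop :=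
  exists t1 t2, a < t1 < b /\ a < t2 < b /\ phi t1 <> phi t2.

(* Main.v *)
Require Import Defs.
From Stdlib Require Import Lra Lia Psatz Classical ClassicalEpsilon List.

(** Write [f = fexp lam], let [beta > 1] be its repelling real fixed point, and
    suppose that a non-constant analytic curve [phi] runs in the hair with
    address [s].  Put [z_n = f^n o phi].

    The half-plane left of [beta] lies in the Fatou set ([fatou_of_Re_lt]), so
    orbits on a hair stay right of [beta], where [f] expands each strip
    ([fexp_expanding]).  Hence two points of a hair separate without bound while
    their imaginary parts stay within [2 PI], and all but at most one of them
    escape to the right ([escaping_or]).  A non-constant curve therefore has a
    parameter [t0] with [phi' t0 <> 0] and escaping orbit
    ([exists_regular_point]).  If [s] were eventually 0, some image of the hair
    would be real, that is, the hair would be trivial; so [s m <> 0] for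
    infinitely many [m] ([nontrivial_address]).

    Analyticity of [phi] at [t0] is inherited by all [z_n] with precise control:
    if [r = R0 / |z_n' t0|], then for large [n] the map [z_n] is within 1 of its
    affine part on the complex disc of radius [r] around [t0] ([linearization]).
    This is expressed through sums of absolute values of Taylor coefficients
    ([l1ball]), a norm under which products and exponentials satisfy the obvious
    majorant estimates ([l1ball_Cexp]), so that no complex integration is needed.

    Now choose [n] large with [s (n + 2) <> 0] and look at the offset
    [y = Im z_(n+1) - 2 PI s (n + 1)] of the curve in its strip, which is the
    principal argument of [z_(n+2)].  Let [X = |z_(n+1) t0|].  As
    [|Im z_(n+2)| >= PI], the offset at [t0] is at least [exp (- X)]
    ([near_offset_ge]).  On the other hand the imaginary parts on one hair differ
    by at most [2 PI], while [|z_(n+2)|] is doubly exponential in [Re z_n]; so a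
    few units further along the hair the offset is below [exp (- 6 X)]
    ([far_offset_le]).  But [y] is real analytic with radius [r], a
    large multiple of the distance travelled, and bounded by a multiple of [X]
    on the disc of that radius.  Extrapolating a Taylor polynomial of degree about
    [X] from the far nodes back to [t0] ([extrapolation]) shows that [y] at [t0]
    is much smaller than [exp (- X)]: a contradiction. *)

(** * Estimates for the complex exponential *)

Lemma Cmod_le_sqr (z : C) (B : R) :
  0 <= B -> Re z ^ 2 + Im z ^ 2 <= B ^ 2 -> Cmod z <= B.
Proof.
  intros hB h. unfold Cmod. rewrite <- (sqrt_pow2 B) by easy.
  apply sqrt_le_1_alt. exact h.
Qed.

Lemma Cmod_le_abs (z : C) : Cmod z <= Rabs (Re z) + Rabs (Im z).
Proof.
  pose proof (Rabs_pos (Re z)); pose proof (Rabs_pos (Im z)).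
  apply Cmod_le_sqr; [lra |].
  rewrite <- (pow2_abs (Re z)), <- (pow2_abs (Im z)). nra.
Qed.

Lemma im_le_Cmod (z : C) : Rabs (Im z) <= Cmod z.
Proof. eapply Rle_trans; [apply Rmax_r | apply Rmax_Cmod]. Qed.

Lemma Re_le_Cmod (z : C) : Re z <= Cmod z.
Proof. eapply Rle_trans; [apply Rle_abs | apply re_le_Cmod]. Qed.

Lemma Cmod_minus_le (z w : C) : Cmod (z - w) <= Cmod z + Cmod w.
Proof. rewrite <- (Cmod_opp w). apply Cmod_triangle. Qed.

Lemma Cmod_sym (z w : C) : Cmod (z - w) = Cmod (w - z).
Proof. rewrite <- Cmod_opp. f_equal. ring. Qed.

Lemma exp_le_mono (x y : R) : x <= y -> exp x <= exp y.
Proof.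
  intros [h | ->]; [left; apply exp_increasing; exact h | apply Rle_refl].
Qed.

Lemma Rabs_sin_le (x : R) : Rabs (sin x) <= Rabs x.
Proof.
  destruct (MVT_gen sin 0 x cos) as [c [_ hc]].
  - intros; auto_derive; auto; ring.
  - intros; apply continuity_sin.
  - rewrite sin_0, !Rminus_0_r in hc. rewrite hc, Rabs_mult.
    pose proof (COS_bound c). pose proof (Rabs_pos x).
    assert (Rabs (cos c) <= 1) by (apply Rabs_le; lra). nra.
Qed.

Lemma one_minus_cos_le (b : R) : 1 - cos b <= b ^ 2 / 2.
Proof.
  replace b with (2 * (b / 2)) at 1 by field. rewrite cos_2a_sin.
  pose proof (Rabs_sin_le (b / 2)) as h.
  assert (sin (b/2) ^ 2 <= (b/2) ^ 2).
  { rewrite <- (pow2_abs (sin _)), <- (pow2_abs (b/2)).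
    apply pow_incr; split; [apply Rabs_pos | exact h]. }
  nra.
Qed.

Lemma Cexp_plus (z w : C) : Cexp (z + w) = (Cexp z * Cexp w)%C.
Proof.
  destruct z as [a b], w as [c d]. unfold Cexp, Cmult, Cplus; simpl.
  rewrite exp_plus, cos_plus, sin_plus. f_equal; ring.
Qed.

Lemma Cmod_Cexp (z : C) : Cmod (Cexp z) = exp (Re z).
Proof.
  unfold Cmod, Cexp; simpl.
  replace (_ + _) with (exp (Re z) * exp (Re z) * ((sin (Im z))² + (cos (Im z))²))
    by (unfold Rsqr; ring).
  rewrite sin2_cos2, Rmult_1_r.
  apply sqrt_square. left; apply exp_pos.
Qed.

Lemma Cexp_RtoC (x : R) : Cexp (RtoC x) = RtoC (exp x).
Proof. unfold Cexp, RtoC; simpl. rewrite cos_0, sin_0. f_equal; ring. Qed.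

(** Along the segment from 0 to [u] the derivative of the exponential is at
    most [Rmax 1 (exp (Re u))] in modulus. *)
Lemma Cexp_minus_1_le (u : C) :
  Cmod (Cexp u - 1) <= Rmax 1 (exp (Re u)) * Cmod u.
Proof.
  destruct u as [a b]. set (m := Rmax 1 (exp (Re (a, b)))).
  assert (h1 : 1 <= m) by apply Rmax_l.
  assert (h2 : exp a <= m) by apply Rmax_r.
  apply Cmod_le_sqr. { apply Rmult_le_pos; [lra | apply Cmod_ge_0]. }
  rewrite Rpow_mult_distr, Cmod2_alt. simpl.
  assert (ha : Rabs (exp a - 1) <= m * Rabs a).
  { destruct (Rle_dec 0 a) as [h | h].
    - assert (1 - a <= exp (- a)) by (pose proof (exp_ineq1_le (- a)); lra).
      assert (exp a * exp (- a) = 1) by (rewrite <- exp_plus, Rplus_opp_r; apply exp_0).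
      pose proof (exp_pos a). pose proof (exp_ineq1_le a).
      rewrite !Rabs_pos_eq by lra. nra.
    - pose proof (exp_ineq1_le a). assert (exp a < 1).
      { rewrite <- exp_0. apply exp_increasing. lra. }
      rewrite !Rabs_left by lra. nra. }
  assert (ha2 : (exp a - 1) ^ 2 <= m ^ 2 * a ^ 2).
  { rewrite <- (pow2_abs (exp a - 1)), <- (pow2_abs a), <- Rpow_mult_distr.
    apply pow_incr; split; [apply Rabs_pos | exact ha]. }
  pose proof (one_minus_cos_le b) as hb. pose proof (exp_pos a).
  pose proof (sin2_cos2 b) as hsc. unfold Rsqr in hsc.
  assert (e : (exp a * cos b + - (1)) * ((exp a * cos b + - (1)) * 1) +
     (exp a * sin b + - 0) * ((exp a * sin b + - 0) * 1)
     = (exp a - 1) ^ 2 + 2 * exp a * (1 - cos b)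
       + exp a ^ 2 * (sin b * sin b + cos b * cos b - 1)) by ring.
  rewrite e, hsc.
  assert (2 * exp a * (1 - cos b) <= m * b ^ 2).
  { apply Rle_trans with (exp a * b ^ 2); nra. }
  assert (m * b ^ 2 <= m ^ 2 * b ^ 2) by nra.
  nra.
Qed.

Lemma Cexp_Taylor1_le (u : C) :
  Cmod u <= 1 / 2 -> Cmod (Cexp u - 1 - u) <= 4 * Cmod u ^ 2.
Proof.
  intros hu. pose proof (re_le_Cmod u) as hre. pose proof (im_le_Cmod u) as him.
  rewrite Cmod2_alt. destruct u as [a b]. simpl in hre, him.
  eapply Rle_trans; [apply Cmod_le_abs |]. simpl.
  assert (hA : Rabs a <= 1 / 2) by lra. assert (hB : Rabs b <= 1 / 2) by lra.
  apply Rabs_le_between in hA.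
  assert (e1 : 0 <= exp a - 1 - a <= 2 * a ^ 2).
  { pose proof (exp_ineq1_le a). pose proof (exp_ineq1_le (- a)).
    assert (exp a * exp (- a) = 1) by (rewrite <- exp_plus, Rplus_opp_r; apply exp_0).
    pose proof (exp_pos a). split; [lra |].
    assert (exp a * (1 - a) <= 1) by nra.
    assert (exp a * (1 - a) <= (1 + a + 2 * a ^ 2) * (1 - a)).
    { nra. }
    nra. }
  assert (e2 : 0 <= 1 - cos b <= b ^ 2 / 2).
  { split; [pose proof (COS_bound b); lra | apply one_minus_cos_le]. }
  assert (e3 : Rabs (sin b - b) <= b ^ 2).
  { destruct (MVT_gen sin 0 b cos) as [c [hc1 hc]].
    - intros; auto_derive; auto; ring.
    - intros; apply continuity_sin.
    - rewrite sin_0, !Rminus_0_r in hc.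
      replace (sin b - b) with (- ((1 - cos c) * b)) by lra.
      rewrite Rabs_Ropp, Rabs_mult, Rabs_pos_eq
        by (pose proof (COS_bound c); lra).
      pose proof (one_minus_cos_le c). rewrite <- (pow2_abs b).
      assert (Rabs c <= Rabs b).
      { revert hc1. unfold Rmin, Rmax, Rabs.
        destruct (Rle_dec 0 b); destruct (Rcase_abs c), (Rcase_abs b); lra. }
      rewrite <- (pow2_abs c) in H. pose proof (Rabs_pos c). pose proof (Rabs_pos b).
      assert (Rabs c ^ 2 <= Rabs b * (1 / 2)) by nra. nra. }
  assert (e4 : Rabs (exp a * cos b + - (1) + - a) <= 2 * a ^ 2 + b ^ 2).
  { assert (exp a <= 2) by nra. pose proof (exp_pos a).
    apply Rabs_le. nra. }
  assert (e5 : Rabs (exp a * sin b + - 0 + - b) <= 2 * Rabs a * Rabs b + b ^ 2).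
  { replace (exp a * sin b + - 0 + - b)
      with ((exp a - 1) * sin b + (sin b - b)) by ring.
    eapply Rle_trans; [apply Rabs_triang |]. rewrite Rabs_mult.
    pose proof (Rabs_sin_le b). pose proof (Rabs_pos (sin b)).
    assert (Rabs (exp a - 1) <= 2 * Rabs a).
    { replace (exp a - 1) with ((exp a - 1 - a) + a) by ring.
      eapply Rle_trans; [apply Rabs_triang |].
      rewrite (Rabs_pos_eq (exp a - 1 - a)) by lra.
      rewrite <- (pow2_abs a) in e1.
      assert (Rabs a <= 1 / 2) by (apply Rabs_le; lra). pose proof (Rabs_pos a). nra. }
    pose proof (Rabs_pos (exp a - 1)). nra. }
  pose proof (pow2_abs a). pose proof (pow2_abs b).
  pose proof (pow2_ge_0 (Rabs a - Rabs b)). simpl in *. nra.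
Qed.

Lemma Cpow_minus_le (x y : C) (K : R) (L : nat) :
  1 <= K -> Cmod x <= K -> Cmod y <= K ->
  Cmod (x ^ L - y ^ L) <= INR L * K ^ L * Cmod (x - y).
Proof.
  intros hK hx hy. induction L as [|L IH].
  - simpl. replace (1 - 1)%C with (RtoC 0) by ring. rewrite Cmod_0. lra.
  - replace (x ^ S L - y ^ S L)%C with (x * (x ^ L - y ^ L) + (x - y) * y ^ L)%C
      by (simpl; ring).
    eapply Rle_trans; [apply Cmod_triangle |]. rewrite !Cmod_mult, Cmod_pow, S_INR.
    pose proof (Cmod_ge_0 (x - y)). pose proof (Cmod_ge_0 x).
    assert (Cmod y ^ L <= K ^ L) by (apply pow_incr; split; [apply Cmod_ge_0 | easy]).
    assert (0 < K ^ L) by (apply pow_lt; lra).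
    assert (K ^ L <= K ^ S L) by (simpl; nra).
    apply Rle_trans with (K * (INR L * K ^ L * Cmod (x - y)) + Cmod (x - y) * K ^ S L).
    + apply Rplus_le_compat.
      * apply Rmult_le_compat; try easy; apply Cmod_ge_0.
      * apply Rmult_le_compat_l; lra.
    + simpl. nra.
Qed.

Lemma Cexp_pow (z : C) (L : nat) : Cexp (RtoC (INR L) * z) = (Cexp z ^ L)%C.
Proof.
  induction L as [|L IH].
  - simpl. replace (0 * z)%C with (RtoC 0) by ring. rewrite Cexp_RtoC, exp_0. easy.
  - rewrite S_INR, RtoC_plus.
    replace ((INR L + 1) * z)%C with (z + INR L * z)%C by ring.
    rewrite Cexp_plus, IH. reflexivity.
Qed.

Lemma exp_INR_mult (L : nat) (x : R) : exp (INR L * x) = exp x ^ L.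
Proof.
  induction L as [|L IH]; [simpl; rewrite Rmult_0_l; apply exp_0|].
  rewrite S_INR, Rmult_plus_distr_r, exp_plus, IH, Rmult_1_l. simpl; ring.
Qed.

Lemma exp_ge_16 (x : R) : 4 <= x -> 16 <= exp x.
Proof.
  intros hx. apply Rle_trans with (exp (INR 4 * 1)).
  - rewrite exp_INR_mult. apply Rle_trans with (2 ^ 4); [lra |].
    apply pow_incr. pose proof (exp_ineq1_le 1). lra.
  - apply exp_le_mono. simpl. lra.
Qed.

Lemma exp_minus_1_le (x : R) : exp x - 1 <= x * exp x.
Proof.
  pose proof (exp_ineq1_le (- x)). pose proof (exp_pos x).
  assert (exp x * exp (- x) = 1) by (rewrite <- exp_plus, Rplus_opp_r; apply exp_0).
  nra.
Qed.

(** Compound interest, with a rate that is uniform on bounded sets. *)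
Lemma Cexp_compound (z : C) (B : R) (L : nat) :
  Cmod z <= B -> 2 * B + 1 <= INR L ->
  Cmod (Cexp z - (1 + z / INR L) ^ L) <= 4 * B ^ 2 * exp B / INR L.
Proof.
  intros hz hL. pose proof (Cmod_ge_0 z) as hz0.
  assert (hL0 : 0 < INR L) by lra.
  assert (hLC : RtoC (INR L) <> 0) by (intros h; apply RtoC_inj in h; lra).
  set (u := (z / INR L)%C).
  assert (hu : Cmod u = Cmod z / INR L).
  { unfold u. rewrite Cmod_div by easy. rewrite Cmod_R, Rabs_pos_eq by lra. easy. }
  assert (ez : Cexp z = (Cexp u ^ L)%C).
  { rewrite <- Cexp_pow. f_equal. unfold u. field. easy. }
  assert (hub : Cmod u <= B / INR L).
  { rewrite hu. apply Rmult_le_compat_r; [left; apply Rinv_0_lt_compat|]; easy. }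
  assert (hb2 : B / INR L <= 1 / 2) by (apply Rle_div_l; lra).
  rewrite ez.
  assert (hK1 : 1 <= exp (B / INR L)).
  { rewrite <- exp_0. apply exp_le_mono. apply Rle_mult_inv_pos; lra. }
  eapply Rle_trans; [apply (Cpow_minus_le _ _ (exp (B / INR L)))|].
  - easy.
  - rewrite Cmod_Cexp. apply exp_le_mono. pose proof (re_le_Cmod u).
    pose proof (Rle_abs (Re u)). lra.
  - eapply Rle_trans; [apply Cmod_triangle|]. rewrite Cmod_1.
    pose proof (exp_ineq1_le (B / INR L)). lra.
  - rewrite <- exp_INR_mult.
    replace (INR L * (B / INR L)) with B by (field; lra).
    replace (Cexp u - (1 + u))%C with (Cexp u - 1 - u)%C by ring.
    pose proof (Cexp_Taylor1_le u ltac:(lra)) as hT.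
    assert (Cmod u ^ 2 <= (B / INR L) ^ 2)
      by (apply pow_incr; split; [apply Cmod_ge_0 | easy]).
    pose proof (exp_pos B).
    apply Rle_trans with (INR L * exp B * (4 * (B / INR L) ^ 2)).
    + apply Rmult_le_compat_l; [|lra]. apply Rmult_le_pos; lra.
    + right. field. lra.
Qed.

(** * Functions with absolutely summable Taylor coefficients *)

Fixpoint peval (p : list C) (w : R) : C :=
  match p with nil => 0 | c :: q => (c + w * peval q w)%C end.

Fixpoint pnorm (r : R) (p : list C) : R :=
  match p with nil => 0 | c :: q => Cmod c + r * pnorm r q end.

Fixpoint padd (p q : list C) : list C :=
  match p, q with
  | nil, _ => q
  | _, nil => p
  | c :: p', d :: q' => (c + d)%C :: padd p' q'
  end.

Definition pscal (c : C) (p : list C) : list C := map (Cmult c) p.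

Fixpoint pmul (p q : list C) : list C :=
  match p with
  | nil => nil
  | c :: p' => padd (pscal c q) (RtoC 0 :: pmul p' q)
  end.

Lemma pnorm_ge_0 (r : R) (p : list C) : 0 <= r -> 0 <= pnorm r p.
Proof.
  intros hr. induction p as [|c p IH]; simpl; [lra |].
  pose proof (Cmod_ge_0 c). nra.
Qed.

Lemma peval_padd (p q : list C) (w : R) :
  peval (padd p q) w = (peval p w + peval q w)%C.
Proof.
  revert q; induction p as [|c p IH]; intros [|d q]; simpl; try ring.
  rewrite IH. ring.
Qed.

Lemma pnorm_padd (r : R) (p q : list C) :
  0 <= r -> pnorm r (padd p q) <= pnorm r p + pnorm r q.
Proof.
  intros hr; revert q; induction p as [|c p IH]; intros [|d q]; simpl; try lra.
  pose proof (Cmod_triangle c d). specialize (IH q). nra.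
Qed.

Lemma peval_pscal (c : C) (p : list C) (w : R) :
  peval (pscal c p) w = (c * peval p w)%C.
Proof.
  unfold pscal. induction p as [|d p IH]; simpl; [ring |]. rewrite IH. ring.
Qed.

Lemma pnorm_pscal (r : R) (c : C) (p : list C) :
  pnorm r (pscal c p) = Cmod c * pnorm r p.
Proof.
  unfold pscal. induction p as [|d p IH]; simpl; [ring |].
  rewrite IH, Cmod_mult. ring.
Qed.

Lemma peval_pmul (p q : list C) (w : R) :
  peval (pmul p q) w = (peval p w * peval q w)%C.
Proof.
  induction p as [|c p IH]; simpl; [ring |].
  rewrite peval_padd, peval_pscal. simpl. rewrite IH. ring.
Qed.

Lemma pnorm_pmul (r : R) (p q : list C) :
  0 <= r -> pnorm r (pmul p q) <= pnorm r p * pnorm r q.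
Proof.
  intros hr. induction p as [|c p IH]; simpl; [lra |].
  eapply Rle_trans; [apply pnorm_padd; easy |].
  rewrite pnorm_pscal. simpl. rewrite Cmod_0. nra.
Qed.

Lemma Cmod_peval_le (r : R) (p : list C) (w : R) :
  Rabs w <= r -> Cmod (peval p w) <= pnorm r p.
Proof.
  intros hw. induction p as [|c p IH]; simpl; [rewrite Cmod_0; lra |].
  eapply Rle_trans; [apply Cmod_triangle |].
  rewrite Cmod_mult, Cmod_R. apply Rplus_le_compat_l.
  apply Rmult_le_compat; try easy; [apply Rabs_pos | apply Cmod_ge_0].
Qed.

(** Up to closure, the functions on [[-r, r]] whose Taylor coefficients
    satisfy [sum |c_j| r^j <= M].  Asking only for uniform approximation by
    polynomials makes the class visibly closed under products and exponentials
    and still gives the Cauchy estimates that a holomorphic extension to the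
    disc of radius [r] would give. *)
Definition l1ball (r M : R) (g : R -> C) : Prop :=
  forall eps, 0 < eps -> exists p, pnorm r p <= M /\
    forall w, Rabs w <= r -> Cmod (g w - peval p w) <= eps.

Lemma l1ball_mono (r M M' : R) (g : R -> C) :
  M <= M' -> l1ball r M g -> l1ball r M' g.
Proof.
  intros hM hg eps he. destruct (hg eps he) as [p [hp h]].
  exists p. split; [lra | exact h].
Qed.

Lemma l1ball_closed (r M : R) (g : R -> C) :
  (forall eps, 0 < eps -> exists g', l1ball r M g' /\
     forall w, Rabs w <= r -> Cmod (g w - g' w) <= eps) ->
  l1ball r M g.
Proof.
  intros H eps he. destruct (H (eps / 2)) as [g' [hg' h]]; [lra |].
  destruct (hg' (eps / 2)) as [p [hp hp']]; [lra |].
  exists p. split; [easy |]. intros w hw.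
  replace (g w - peval p w)%C with ((g w - g' w) + (g' w - peval p w))%C by ring.
  eapply Rle_trans; [apply Cmod_triangle |].
  specialize (h w hw). specialize (hp' w hw). lra.
Qed.

Lemma l1ball_ext (r M : R) (g g' : R -> C) :
  (forall w, Rabs w <= r -> g w = g' w) -> l1ball r M g -> l1ball r M g'.
Proof.
  intros H hg eps he. destruct (hg eps he) as [p [hp h]].
  exists p. split; [easy |]. intros w hw. rewrite <- H; auto.
Qed.

Lemma l1ball_bound (r M : R) (g : R -> C) (w : R) :
  l1ball r M g -> Rabs w <= r -> Cmod (g w) <= M.
Proof.
  intros hg hw. apply le_epsilon. intros eps he.
  destruct (hg eps he) as [p [hp h]]. specialize (h w hw).
  replace (g w) with (peval p w + (g w - peval p w))%C by ring.
  eapply Rle_trans; [apply Cmod_triangle |].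
  pose proof (Cmod_peval_le r p w hw). lra.
Qed.

Lemma l1ball_ge_0 (r M : R) (g : R -> C) : 0 <= r -> l1ball r M g -> 0 <= M.
Proof.
  intros hr hg. apply Rle_trans with (Cmod (g 0)); [apply Cmod_ge_0 |].
  apply (l1ball_bound r); [easy |]. rewrite Rabs_R0; easy.
Qed.

Lemma l1ball_peval (r : R) (p : list C) : l1ball r (pnorm r p) (peval p).
Proof.
  intros eps he. exists p. split; [lra |]. intros w _.
  replace (peval p w - peval p w)%C with (RtoC 0) by ring. rewrite Cmod_0; lra.
Qed.

Lemma l1ball_const (r : R) (c : C) : l1ball r (Cmod c) (fun _ => c).
Proof.
  apply l1ball_ext with (peval (c :: nil)); [intros; simpl; ring |].
  eapply l1ball_mono; [|apply l1ball_peval]. simpl. lra.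
Qed.

Lemma l1ball_linear (r : R) (d : C) : l1ball r (Cmod d * r) (fun w => d * w)%C.
Proof.
  apply l1ball_ext with (peval (RtoC 0 :: d :: nil)); [intros; simpl; ring |].
  eapply l1ball_mono; [|apply l1ball_peval]. simpl. rewrite Cmod_0. lra.
Qed.

Lemma l1ball_plus (r M M' : R) (g g' : R -> C) :
  0 <= r -> l1ball r M g -> l1ball r M' g' ->
  l1ball r (M + M') (fun w => g w + g' w)%C.
Proof.
  intros hr hg hg' eps he.
  destruct (hg (eps / 2)) as [p [hp h]]; [lra |].
  destruct (hg' (eps / 2)) as [q [hq h']]; [lra |].
  exists (padd p q). split.
  - pose proof (pnorm_padd r p q hr). lra.
  - intros w hw. rewrite peval_padd.
    replace (g w + g' w - (peval p w + peval q w))%C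
      with ((g w - peval p w) + (g' w - peval q w))%C by ring.
    eapply Rle_trans; [apply Cmod_triangle |].
    specialize (h w hw). specialize (h' w hw). lra.
Qed.

Lemma l1ball_mult (r M M' : R) (g g' : R -> C) :
  0 <= r -> l1ball r M g -> l1ball r M' g' ->
  l1ball r (M * M') (fun w => g w * g' w)%C.
Proof.
  intros hr hg hg' eps he.
  pose proof (l1ball_ge_0 _ _ _ hr hg). pose proof (l1ball_ge_0 _ _ _ hr hg').
  assert (hd : 0 < eps / (M + M' + 1)) by (apply Rdiv_lt_0_compat; lra).
  destruct (hg _ hd) as [p [hp h]]. destruct (hg' _ hd) as [q [hq h']].
  exists (pmul p q). split.
  - eapply Rle_trans; [apply pnorm_pmul; easy |].
    apply Rmult_le_compat; try easy; apply pnorm_ge_0; easy.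
  - intros w hw. rewrite peval_pmul.
    replace (g w * g' w - peval p w * peval q w)%C
      with (g w * (g' w - peval q w) + (g w - peval p w) * peval q w)%C by ring.
    eapply Rle_trans; [apply Cmod_triangle |]. rewrite !Cmod_mult.
    specialize (h w hw). specialize (h' w hw).
    pose proof (l1ball_bound _ _ _ _ hg hw).
    pose proof (Cmod_peval_le r q w hw).
    apply Rle_trans with (M * (eps / (M + M' + 1)) + eps / (M + M' + 1) * M').
    + apply Rplus_le_compat; apply Rmult_le_compat; try easy; try apply Cmod_ge_0; lra.
    + apply Rle_trans with ((M + M') * (eps / (M + M' + 1))); [lra |].
      apply Rle_trans with ((M + M' + 1) * (eps / (M + M' + 1))); [nra |].
      right; field; lra.
Qed.

Lemma l1ball_scal (r M : R) (c : C) (g : R -> C) :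
  0 <= r -> l1ball r M g -> l1ball r (Cmod c * M) (fun w => c * g w)%C.
Proof.
  intros hr hg.
  exact (l1ball_mult _ _ _ _ _ hr (l1ball_const r c) hg).
Qed.

(** By induction on [m]: the coefficients of [(1 + x / L) ^ m - 1 - m x / L] are
    non-negative. *)
Lemma l1ball_compound (r M : R) (g : R -> C) (L : nat) (m : nat) :
  0 <= r -> (0 < L)%nat -> l1ball r M g ->
  l1ball r ((1 + M / INR L) ^ m - 1 - INR m * M / INR L)
    (fun w => (1 + g w / INR L) ^ m - 1 - INR m * g w / INR L)%C.
Proof.
  intros hr hL hg. apply lt_INR in hL. simpl in hL.
  assert (hLC : RtoC (INR L) <> 0) by (intros h; apply RtoC_inj in h; lra).
  assert (hc : Cmod (/ INR L) = / INR L).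
  { rewrite Cmod_inv by easy. rewrite Cmod_R, Rabs_pos_eq; lra. }
  induction m as [|m IH].
  - simpl. apply l1ball_ext with (fun _ => RtoC 0); [intros; field; easy |].
    eapply l1ball_mono; [|apply l1ball_const]. rewrite Cmod_0. right; field; lra.
  - apply l1ball_ext with (fun w =>
      (1 + / INR L * g w) * ((1 + g w / INR L) ^ m - 1 - INR m * g w / INR L)
      + (INR m * / INR L * / INR L) * (g w * g w))%C.
    + intros w _. rewrite S_INR, RtoC_plus. simpl. field. easy.
    + eapply l1ball_mono.
      2:{ apply l1ball_plus; [easy | |].
          - apply l1ball_mult; [easy | | exact IH].
            apply l1ball_plus; [easy | apply l1ball_const |].
            apply l1ball_scal; eassumption.
          - apply l1ball_scal; [easy |]. apply l1ball_mult; eassumption. }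
      rewrite !Cmod_mult, hc, Cmod_1, Cmod_R, Rabs_pos_eq by apply pos_INR.
      rewrite S_INR. simpl. right. field. lra.
Qed.

(** The exponential series has non-negative coefficients, so its tail
    [exp - 1 - id] maps the ball of radius [M] into the ball whose radius is
    the value of that tail at [M]. *)
Lemma l1ball_Cexp (r M : R) (g : R -> C) :
  0 <= r -> l1ball r M g ->
  l1ball r (exp M - 1 - M) (fun w => Cexp (g w) - 1 - g w)%C.
Proof.
  intros hr hg. pose proof (l1ball_ge_0 _ _ _ hr hg) as hM.
  apply l1ball_closed. intros eps he.
  set (K := 4 * M ^ 2 * exp M).
  destruct (INR_unbounded (2 * M + 1 + K / eps)) as [L hL].
  assert (hK : 0 <= K) by (unfold K; pose proof (exp_pos M); nra).
  assert (hK' : 0 <= K / eps) by (apply Rdiv_le_0_compat; lra).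
  assert (hL0 : 0 < INR L) by lra.
  assert (hLC : RtoC (INR L) <> 0) by (intros h; apply RtoC_inj in h; lra).
  exists (fun w => (1 + g w / INR L) ^ L - 1 - INR L * g w / INR L)%C. split.
  - eapply l1ball_mono; [|apply l1ball_compound; [easy | | exact hg]].
    + replace (INR L * M / INR L) with M by (field; lra).
      do 2 apply Rplus_le_compat_r.
      apply Rle_trans with (exp (M / INR L) ^ L).
      * assert (0 <= M / INR L) by (apply Rdiv_le_0_compat; lra).
        apply pow_incr. split; [lra | apply exp_ineq1_le].
      * rewrite <- exp_INR_mult. right. f_equal. field. lra.
    + apply INR_lt. simpl. lra.
  - intros w hw.
    replace (Cexp (g w) - 1 - g w - ((1 + g w / INR L) ^ L - 1 - INR L * g w / INR L))%C
      with (Cexp (g w) - (1 + g w / INR L) ^ L)%C by (field; easy).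
    eapply Rle_trans; [apply (Cexp_compound _ M) |].
    + apply (l1ball_bound r); easy.
    + lra.
    + fold K. apply Rle_div_l; [easy |].
      apply Rle_trans with (eps * (K / eps)); [right; field; lra |]. nra.
Qed.

(** One step of the iteration: the image of a nearly affine arc
    [c + d w + O(q)] under the exponential family is nearly affine again, with
    the derivative multiplied by the image point. *)
Lemma l1ball_fexp_affine (lam r q : R) (c d : C) (g : R -> C) :
  0 <= r -> l1ball r q (fun w : R => g w - c - d * w)%C ->
  let N := Cmod d * r + q in
  let b := fexp lam c in
  l1ball r (Cmod b * (q + (exp N - 1 - N)))
    (fun w : R => fexp lam (g w) - b - (b * d) * w)%C.
Proof.
  intros hr hg N b.
  assert (hu : l1ball r N (fun w => g w - c)%C).
  { apply l1ball_ext with (fun w : R => d * w + (g w - c - d * w))%C;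
      [intros; ring |].
    apply l1ball_plus; [easy | apply l1ball_linear | exact hg]. }
  apply l1ball_ext with (fun w : R =>
    b * ((g w - c - d * w) + (Cexp (g w - c) - 1 - (g w - c))))%C.
  - intros w _. unfold b, fexp.
    assert (e : Cexp (g w) = (Cexp c * Cexp (g w - c))%C)
      by (rewrite <- Cexp_plus; f_equal; ring).
    rewrite e. ring.
  - apply l1ball_scal; [easy |]. apply l1ball_plus; [easy | exact hg |].
    apply l1ball_Cexp; easy.
Qed.

Lemma l1ball_fexp (lam r N : R) (c : C) (g : R -> C) :
  0 <= r -> l1ball r N (fun w => g w - c)%C ->
  l1ball r (Cmod (fexp lam c) * exp N) (fun w => fexp lam (g w)).
Proof.
  intros hr hu.
  apply l1ball_ext with (fun w =>
    fexp lam c * ((1 + (g w - c)) + (Cexp (g w - c) - 1 - (g w - c))))%C.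
  - intros w _. unfold fexp.
    assert (e : Cexp (g w) = (Cexp c * Cexp (g w - c))%C)
      by (rewrite <- Cexp_plus; f_equal; ring).
    rewrite e. ring.
  - apply l1ball_scal; [easy |].
    apply l1ball_mono with ((Cmod 1 + N) + (exp N - 1 - N)).
    { rewrite Cmod_1. lra. }
    apply l1ball_plus; [easy | | apply l1ball_Cexp; easy].
    apply l1ball_plus; [easy | apply l1ball_const | exact hu].
Qed.

(** * Polynomial extrapolation *)

(** The values at the natural numbers of a polynomial of degree less than [m]
    are those sequences whose [m]-th forward difference vanishes. *)
Fixpoint diff_vanishes (m : nat) (Q : nat -> R) : Prop :=
  match m with
  | O => forall j, Q j = 0
  | S m' => diff_vanishes m' (fun j => Q (S j) - Q j)
  end.

Lemma diff_vanishes_ext (m : nat) (Q Q' : nat -> R) :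
  (forall j, Q j = Q' j) -> diff_vanishes m Q -> diff_vanishes m Q'.
Proof.
  revert Q Q'; induction m as [|m IH]; simpl; intros Q Q' e h.
  - intros j. rewrite <- e. apply h.
  - refine (IH _ _ _ h). intros j. simpl. rewrite !e. easy.
Qed.

Lemma diff_vanishes_plus (m : nat) (Q Q' : nat -> R) :
  diff_vanishes m Q -> diff_vanishes m Q' -> diff_vanishes m (fun j => Q j + Q' j).
Proof.
  revert Q Q'; induction m as [|m IH]; simpl; intros Q Q' h h'.
  - intros j. rewrite h, h'. ring.
  - refine (diff_vanishes_ext _ _ _ _ (IH _ _ h h')). intros j; simpl; ring.
Qed.

Lemma diff_vanishes_scal (m : nat) (c : R) (Q : nat -> R) :
  diff_vanishes m Q -> diff_vanishes m (fun j => c * Q j).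
Proof.
  revert Q; induction m as [|m IH]; simpl; intros Q h.
  - intros j. rewrite h. ring.
  - refine (diff_vanishes_ext _ _ _ _ (IH _ h)). intros j; simpl; ring.
Qed.

Lemma diff_vanishes_const (m : nat) (c : R) : diff_vanishes (S m) (fun _ => c).
Proof.
  assert (h : forall k, diff_vanishes k (fun _ => 0)).
  { induction k as [|k IH]; simpl; [easy |].
    refine (diff_vanishes_ext _ _ _ _ IH). intros; ring. }
  simpl. refine (diff_vanishes_ext _ _ _ _ (h m)). intros; ring.
Qed.

Lemma diff_vanishes_linear_mult (m : nat) (a b : R) (Q : nat -> R) :
  diff_vanishes m Q -> diff_vanishes (S m) (fun j => (a + b * INR j) * Q j).
Proof.
  revert a Q; induction m as [|m IH]; intros a Q h.
  - simpl in *. intros j. rewrite !h. ring.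
  - assert (h' := IH (a + b) _ h).
    change (diff_vanishes (S m)
      (fun j => (a + b * INR (S j)) * Q (S j) - (a + b * INR j) * Q j)).
    refine (diff_vanishes_ext _ _ _ _
      (diff_vanishes_plus _ _ _ h' (diff_vanishes_scal _ b _ h))).
    intros j. cbv beta. rewrite S_INR. ring.
Qed.

(** Since [Q 0 = Q 1 - (Q 1 - Q 0)], a sequence with vanishing [m]-th difference
    is determined at 0 by its next [m] values. *)
Lemma diff_vanishes_at_0 (m : nat) (Q : nat -> R) (B : R) :
  0 <= B -> diff_vanishes m Q ->
  (forall j, (1 <= j <= m)%nat -> Rabs (Q j) <= B) ->
  Rabs (Q O) <= 2 ^ m * B.
Proof.
  assert (H : 0 <= B -> diff_vanishes m Q ->
    (forall j, (1 <= j <= m)%nat -> Rabs (Q j) <= B) ->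
    Rabs (Q O) <= (2 ^ m - 1) * B).
  { revert Q B; induction m as [|m IH]; intros Q B hB h hj.
    - simpl in h. rewrite h, Rabs_R0. simpl; lra.
    - assert (h1 := IH _ (2 * B) ltac:(lra) h). simpl in h1.
      assert (h2 : Rabs (Q 1%nat - Q O) <= (2 ^ m - 1) * (2 * B)).
      { apply h1. intros j hj'. eapply Rle_trans; [apply Rabs_triang |].
        rewrite Rabs_Ropp. pose proof (hj (S j) ltac:(lia)).
        pose proof (hj j ltac:(lia)). lra. }
      pose proof (hj 1%nat ltac:(lia)).
      replace (Q O) with (Q 1%nat + - (Q 1%nat - Q O)) by ring.
      eapply Rle_trans; [apply Rabs_triang |]. rewrite Rabs_Ropp. simpl. lra. }
  intros hB h hj. specialize (H hB h hj). nra.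
Qed.

(** The polynomial of degree [N] with value 1 at 0 and roots [1, ..., N]. *)
Fixpoint node_poly (N : nat) (j : nat) : R :=
  match N with
  | O => 1
  | S N' => (1 + - / INR (S N') * INR j) * node_poly N' j
  end.

Lemma node_poly_S (N j : nat) :
  node_poly (S N) j = (1 + - / INR (S N) * INR j) * node_poly N j.
Proof. reflexivity. Qed.

Lemma node_poly_0 (N : nat) : node_poly N 0 = 1.
Proof. induction N as [|N IH]; [easy |]. rewrite node_poly_S, IH. simpl (INR 0). ring. Qed.

Lemma node_poly_root (N j : nat) : (1 <= j <= N)%nat -> node_poly N j = 0.
Proof.
  induction N as [|N IH]; intros h; [lia |]. rewrite node_poly_S.
  destruct (Nat.eq_dec j (S N)) as [-> | hj].
  - pose proof (lt_0_INR (S N) ltac:(lia)).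
    replace (1 + - / INR (S N) * INR (S N)) with 0 by (field; lra). ring.
  - rewrite IH by lia. ring.
Qed.

Lemma pow_fact_le_exp (x : R) (n : nat) : 0 <= x -> x ^ n / INR (fact n) <= exp x.
Proof.
  intros hx. eapply Rle_trans; [| apply (exp_ge_taylor x n hx)].
  destruct n as [|n]; [simpl; lra |]. rewrite tech5.
  assert (0 <= sum_f_R0 (fun k => x ^ k / INR (fact k)) n); [|lra].
  apply cond_pos_sum. intros k. apply Rdiv_le_0_compat.
  - apply pow_le; easy.
  - apply INR_fact_lt_0.
Qed.

Lemma node_poly_le (N j : nat) :
  (j <= 2 * N)%nat -> Rabs (node_poly N j) <= exp (2 * INR N).
Proof.
  intros hj.
  assert (H : forall m, (m <= N)%nat ->
    Rabs (node_poly m j) <= (2 * INR N) ^ m / INR (fact m)).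
  { induction m as [|m IH]; intros hm.
    - simpl. rewrite Rabs_R1. lra.
    - specialize (IH ltac:(lia)). rewrite node_poly_S. rewrite Rabs_mult.
      assert (hm0 : 0 < INR (S m)) by (apply lt_0_INR; lia).
      assert (e : Rabs (1 + - / INR (S m) * INR j) <= 2 * INR N / INR (S m)).
      { replace (1 + - / INR (S m) * INR j) with ((INR (S m) - INR j) / INR (S m))
          by (field; lra).
        rewrite Rabs_div, (Rabs_pos_eq (INR (S m))) by lra.
        apply Rmult_le_compat_r; [left; apply Rinv_0_lt_compat; easy |].
        apply le_INR in hj. rewrite mult_INR in hj. simpl (INR 2) in hj.
        apply le_INR in hm. pose proof (pos_INR j). pose proof (pos_INR (S m)).
        apply Rabs_le. lra. }
      pose proof (INR_fact_lt_0 m).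
      rewrite fact_simpl, mult_INR.
      apply Rle_trans with
        (2 * INR N / INR (S m) * ((2 * INR N) ^ m / INR (fact m))).
      + apply Rmult_le_compat; try easy; apply Rabs_pos.
      + right. simpl pow. field. lra. }
  eapply Rle_trans; [apply (H N); lia |]. apply pow_fact_le_exp.
  pose proof (pos_INR N); lra.
Qed.

Lemma diff_vanishes_node_poly (N m : nat) (Q : nat -> R) :
  diff_vanishes m Q -> diff_vanishes (N + m) (fun j => node_poly N j * Q j).
Proof.
  intros h. induction N as [|N IH].
  - refine (diff_vanishes_ext _ _ _ _ h). intros; simpl; ring.
  - refine (diff_vanishes_ext _ _ _ _
      (diff_vanishes_linear_mult _ 1 (- / INR (S N)) _ IH)).
    intros j. rewrite node_poly_S. ring.
Qed.

(** Multiplying by [node_poly N] removes the nodes [1, ..., N] from the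
    vanishing difference of order [2 N], so that the value at 0 is controlled
    by far away nodes only, with a constant that is exponential in [N]. *)
Lemma extrapolation_poly (N : nat) (Q : nat -> R) (B : R) :
  0 <= B -> diff_vanishes N Q ->
  (forall j, (N < j <= 2 * N)%nat -> Rabs (Q j) <= B) ->
  Rabs (Q O) <= exp (4 * INR N) * B.
Proof.
  intros hB h hj. pose proof (exp_pos (2 * INR N)) as hE.
  assert (H : Rabs (node_poly N 0 * Q O) <= 2 ^ (N + N) * (exp (2 * INR N) * B)).
  { apply (diff_vanishes_at_0 (N + N) (fun j => node_poly N j * Q j)).
    - nra.
    - apply diff_vanishes_node_poly; easy.
    - intros j hj'. rewrite Rabs_mult.
      destruct (Nat.le_gt_cases j N) as [hN | hN].
      + rewrite node_poly_root by lia. rewrite Rabs_R0. nra.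
      + apply Rmult_le_compat; try apply Rabs_pos.
        * apply node_poly_le; lia.
        * apply hj; lia. }
  rewrite node_poly_0, Rmult_1_l in H. eapply Rle_trans; [exact H |].
  assert (h2 : 2 ^ (N + N) <= exp (2 * INR N)).
  { replace (2 * INR N) with (INR (N + N) * 1) by (rewrite plus_INR; ring).
    rewrite exp_INR_mult. apply pow_incr. pose proof (exp_ineq1_le 1). lra. }
  replace (4 * INR N) with (2 * INR N + 2 * INR N) by ring. rewrite exp_plus.
  rewrite <- Rmult_assoc. apply Rmult_le_compat_r; [easy |].
  apply Rmult_le_compat_r; lra.
Qed.

(** The terms of degree at least [N] contribute at most [(|w| / r) ^ N] times
    the norm; what is left, seen on the nodes [j h], is a polynomial in [j]. *)
Lemma Im_peval_split (N : nat) (p : list C) (r h theta : R) :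
  0 < r -> 0 <= theta <= 1 -> 2 * INR N * Rabs h <= theta * r ->
  exists A : nat -> R, diff_vanishes N A /\
    forall j, (j <= 2 * N)%nat ->
      Rabs (Im (peval p (INR j * h)) - A j) <= theta ^ N * pnorm r p.
Proof.
  intros hr hth hh.
  set (K := (2 * N)%nat) in *.
  assert (hK : INR K * Rabs h <= theta * r).
  { unfold K. rewrite mult_INR. exact hh. }
  clearbody K. clear hh. revert p.
  induction N as [|N IH]; intros p.
  - exists (fun _ => 0). split; [simpl; easy |]. intros j hj.
    rewrite Rminus_0_r. simpl. rewrite Rmult_1_l.
    eapply Rle_trans; [apply im_le_Cmod |]. apply Cmod_peval_le.
    rewrite Rabs_mult, Rabs_pos_eq by apply pos_INR. apply le_INR in hj.
    pose proof (Rabs_pos h). nra.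
  - destruct p as [|c p].
    + exists (fun _ => 0). split; [apply diff_vanishes_const |]. intros j _.
      simpl. rewrite Rminus_0_r, Rabs_R0. lra.
    + destruct (IH p) as [A [hA h']].
      exists (fun j => (Im c) + (0 + h * INR j) * A j). split.
      * apply diff_vanishes_plus; [apply diff_vanishes_const |].
        apply diff_vanishes_linear_mult; easy.
      * intros j hj. specialize (h' j hj). simpl peval.
        replace (Im (c + RtoC (INR j * h) * peval p (INR j * h)) -
           (Im c + (0 + h * INR j) * A j))
          with ((INR j * h) * (Im (peval p (INR j * h)) - A j))
          by (unfold Im, Cplus, Cmult, RtoC; simpl; ring).
        rewrite Rabs_mult.
        assert (hj2 : Rabs (INR j * h) <= theta * r).
        { rewrite Rabs_mult, Rabs_pos_eq by apply pos_INR. apply le_INR in hj.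
          pose proof (Rabs_pos h). nra. }
        apply Rle_trans with (theta * r * (theta ^ N * pnorm r p)).
        { apply Rmult_le_compat; try apply Rabs_pos; easy. }
        simpl. pose proof (Cmod_ge_0 c).
        assert (0 <= theta * theta ^ N).
        { apply Rmult_le_pos; [|apply pow_le]; lra. }
        nra.
Qed.

(** A function in the ball of radius [M] that is tiny on the far half of an
    interval much shorter than [r] is small at the near end: its Taylor
    polynomial of degree less than [N] is extrapolated, and the remainder is at
    most [theta ^ N * M]. *)
Lemma extrapolation (N : nat) (r M h theta B : R) (g : R -> C) :
  0 < r -> 0 <= theta <= 1 -> 2 * INR N * Rabs h <= theta * r -> 0 <= B ->
  l1ball r M g ->
  (forall j, (N < j <= 2 * N)%nat -> Rabs (Im (g (INR j * h))) <= B) ->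
  Rabs (Im (g 0)) <= exp (4 * INR N) * (B + 2 * (theta ^ N * M)).
Proof.
  intros hr hth hh hB hg hj. apply le_epsilon. intros eps he.
  pose proof (exp_pos (4 * INR N)) as hE.
  assert (hE1 : 1 <= exp (4 * INR N)).
  { rewrite <- exp_0. apply exp_le_mono. pose proof (pos_INR N). lra. }
  set (E := exp (4 * INR N)) in *.
  destruct (hg (eps / (2 * E))) as [p [hp hap]].
  { apply Rdiv_lt_0_compat; lra. }
  set (d := eps / (2 * E)) in *.
  assert (hd : 2 * E * d = eps) by (unfold d; field; lra).
  assert (hd0 : 0 < d) by (unfold d; apply Rdiv_lt_0_compat; lra).
  destruct (Im_peval_split N p r h theta hr hth hh) as [A [hA hAp]].
  assert (ht : 0 <= theta ^ N) by (apply pow_le; lra).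
  pose proof (pnorm_ge_0 r p ltac:(lra)) as hp0.
  assert (hT : theta ^ N * pnorm r p <= theta ^ N * M)
    by (apply Rmult_le_compat_l; easy).
  assert (hcl : forall j, (j <= 2 * N)%nat ->
    Rabs (Im (g (INR j * h)) - A j) <= d + theta ^ N * M).
  { intros j hj'. specialize (hAp j hj').
    assert (hw : Rabs (INR j * h) <= r).
    { rewrite Rabs_mult, Rabs_pos_eq by apply pos_INR. apply le_INR in hj'.
      rewrite mult_INR in hj'. simpl (INR 2) in hj'. pose proof (Rabs_pos h). nra. }
    specialize (hap _ hw).
    pose proof (im_le_Cmod (g (INR j * h) - peval p (INR j * h))) as hi.
    replace (Im (g (INR j * h)) - A j)
      with (Im (g (INR j * h) - peval p (INR j * h))
            + (Im (peval p (INR j * h)) - A j))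
      by (unfold Im, Cminus, Cplus, Copp; simpl; ring).
    eapply Rle_trans; [apply Rabs_triang |]. lra. }
  assert (hTM : 0 <= theta ^ N * M) by nra.
  assert (hA0 : Rabs (A O) <= E * (B + (d + theta ^ N * M))).
  { apply extrapolation_poly; [lra | easy |]. intros j hj'.
    specialize (hj j hj'). specialize (hcl j ltac:(lia)).
    replace (A j) with (Im (g (INR j * h)) - (Im (g (INR j * h)) - A j)) by ring.
    eapply Rle_trans; [apply Rabs_triang |]. rewrite Rabs_Ropp. lra. }
  specialize (hcl O ltac:(lia)). simpl in hcl. rewrite Rmult_0_l in hcl.
  replace (Im (g 0)) with (A O + (Im (g 0) - A O)) by ring.
  eapply Rle_trans; [apply Rabs_triang |].
  nra.
Qed.

(** * The basin of the attracting fixed point *)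

Lemma lam_exp1_lt_1 (lam : R) : 0 < lam < / exp 1 -> lam * exp 1 < 1.
Proof.
  intros [h1 h2]. pose proof (exp_pos 1).
  apply Rmult_lt_compat_r with (r := exp 1) in h2; [|easy].
  rewrite Rinv_l in h2 by lra. exact h2.
Qed.

Lemma continuity_fixed_gap (lam : R) : continuity (fun x => lam * exp x - x).
Proof.
  intros x. apply continuity_pt_minus.
  - apply continuity_pt_scal. apply derivable_continuous_pt, derivable_pt_exp.
  - apply derivable_continuous_pt, derivable_pt_id.
Qed.

Lemma exists_repelling (lam : R) :
  0 < lam < / exp 1 -> exists beta, 1 < beta /\ lam * exp beta = beta.
Proof.
  intros hl. pose proof (lam_exp1_lt_1 lam hl) as h1.
  assert (he : 1 <= exp 1) by (pose proof (exp_ineq1_le 1); lra).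
  assert (hb : 1 < 4 / lam) by (apply Rlt_div_r; nra).
  destruct (IVT_gen (fun x => lam * exp x - x) 1 (4 / lam) 0) as [x [hx1 hx2]].
  - apply continuity_fixed_gap.
  - assert (lam * exp 1 - 1 <= 0) by lra.
    assert (0 <= lam * exp (4 / lam) - 4 / lam).
    { assert (e : 4 / lam = 2 / lam + 2 / lam) by (field; lra).
      rewrite e, exp_plus, <- e. pose proof (exp_ineq1_le (2 / lam)) as h.
      assert (h0 : 0 < 2 / lam) by (apply Rdiv_lt_0_compat; lra).
      assert (h2 : lam * (2 / lam) = 2) by (field; lra).
      replace (4 / lam) with (lam * (2 / lam) * (2 / lam)) by (field; lra).
      nra. }
    split.
    + eapply Rle_trans; [apply Rmin_l | lra].
    + eapply Rle_trans; [| apply Rmax_r]. lra.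
  - exists x. rewrite Rmin_left, Rmax_right in hx1 by lra.
    split; [|lra]. destruct hx1 as [[h | h] _]; [easy |].
    rewrite <- h in hx2. lra.
Qed.

Lemma exists_attracting (lam : R) :
  0 < lam < / exp 1 -> exists alpha, 0 <= alpha <= 1 /\ lam * exp alpha = alpha.
Proof.
  intros hl. pose proof (lam_exp1_lt_1 lam hl) as h1.
  destruct (IVT_gen (fun x => lam * exp x - x) 0 1 0) as [x [hx1 hx2]].
  - apply continuity_fixed_gap.
  - rewrite exp_0. split.
    + eapply Rle_trans; [apply Rmin_r | lra].
    + eapply Rle_trans; [| apply Rmax_l]. lra.
  - exists x. rewrite Rmin_left, Rmax_right in hx1 by lra. split; [easy | lra].
Qed.

(** Cross-multiplied monotonicity of [exp x / x] on [[1, oo)]. *)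
Lemma exp_ratio_lt (x y : R) : 1 <= y < x -> exp y * x < exp x * y.
Proof.
  intros h. replace x with (y + (x - y)) at 2 by ring. rewrite exp_plus.
  pose proof (exp_ineq1 (x - y) ltac:(lra)). pose proof (exp_pos y).
  rewrite Rmult_assoc. apply Rmult_lt_compat_l; [easy |]. nra.
Qed.

Lemma exp_ratio_le (x y : R) : 1 <= y <= x -> exp y * x <= exp x * y.
Proof.
  intros [h [h' | <-]]; [left; apply exp_ratio_lt; lra | right; ring].
Qed.

Lemma Cmod_fexp (lam : R) (z : C) : 0 < lam -> Cmod (fexp lam z) = lam * exp (Re z).
Proof.
  intros h. unfold fexp. rewrite Cmod_mult, Cmod_R, Cmod_Cexp, Rabs_pos_eq; lra.
Qed.

Lemma fexp_minus (lam : R) (z w : C) :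
  (fexp lam z - fexp lam w = fexp lam w * (Cexp (z - w) - 1))%C.
Proof.
  unfold fexp. replace (Cexp z) with (Cexp w * Cexp (z - w))%C.
  - ring.
  - rewrite <- Cexp_plus. f_equal. ring.
Qed.

Lemma fexp_continuous (lam : R) (z : C) (eps : R) : 0 < eps ->
  exists delta, 0 < delta /\ forall w, Cmod (w - z) < delta ->
    Cmod (fexp lam w - fexp lam z) < eps.
Proof.
  intros he. pose proof (Cmod_ge_0 (fexp lam z)) as h0. pose proof (exp_pos 1) as h1.
  set (K := Cmod (fexp lam z) * exp 1 + 1).
  assert (hK : 0 < K) by (unfold K; nra).
  exists (Rmin 1 (eps / K)). split.
  { apply Rmin_glb_lt; [lra | apply Rdiv_lt_0_compat; easy]. }
  intros w hw. rewrite fexp_minus, Cmod_mult.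
  assert (hw1 : Cmod (w - z) < 1) by (eapply Rlt_le_trans; [exact hw | apply Rmin_l]).
  assert (hw2 : Cmod (w - z) < eps / K)
    by (eapply Rlt_le_trans; [exact hw | apply Rmin_r]).
  apply (Rlt_div_r _ _ _ hK) in hw2.
  pose proof (Cexp_minus_1_le (w - z)) as h. pose proof (Cmod_ge_0 (w - z)).
  assert (hm : Rmax 1 (exp (Re (w - z))) <= exp 1).
  { apply Rmax_lub; [pose proof (exp_ineq1_le 1); lra |]. apply exp_le_mono.
    pose proof (re_le_Cmod (w - z)). pose proof (Rle_abs (Re (w - z))). lra. }
  pose proof (Cmod_ge_0 (Cexp (w - z) - 1)).
  assert (Cmod (Cexp (w - z) - 1) <= exp 1 * Cmod (w - z)) by nra.
  unfold K in hw2. nra.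
Qed.

Lemma iter_fexp_continuous (lam : R) (m : nat) (z : C) (eps : R) : 0 < eps ->
  exists delta, 0 < delta /\ forall w, Cmod (w - z) < delta ->
    Cmod (iter (fexp lam) m w - iter (fexp lam) m z) < eps.
Proof.
  revert eps. induction m as [|m IH]; intros eps he.
  - exists eps. split; easy.
  - destruct (fexp_continuous lam (iter (fexp lam) m z) eps he) as [d [hd h]].
    destruct (IH d hd) as [d' [hd' h']]. exists d'. split; [easy |].
    intros w hw. apply h, h', hw.
Qed.

Lemma open_iter_Re_lt (lam : R) (m : nat) (x : R) :
  open (fun w : C => Re (iter (fexp lam) m w) < x).
Proof.
  intros z hz.
  destruct (iter_fexp_continuous lam m z (x - Re (iter (fexp lam) m z)))
    as [d [hd h]]; [lra |].
  assert (hd2 : 0 < d / 2) by lra.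
  exists (mkposreal _ hd2). intros w [h1 h2].
  assert (hw : Cmod (w - z) < d).
  { eapply Rle_lt_trans; [apply Cmod_le_abs |].
    change (Rabs (Re w - Re z) < d / 2) in h1.
    change (Rabs (Im w - Im z) < d / 2) in h2.
    change (Rabs (Re w - Re z) + Rabs (Im w - Im z) < d). lra. }
  specialize (h w hw).
  pose proof (re_le_Cmod (iter (fexp lam) m w - iter (fexp lam) m z)) as hr.
  pose proof (Rle_abs (Re (iter (fexp lam) m w - iter (fexp lam) m z))) as hr'.
  change (Re (iter (fexp lam) m w - iter (fexp lam) m z))
    with (Re (iter (fexp lam) m w) - Re (iter (fexp lam) m z)) in *. lra.
Qed.

Lemma iter_add (g : C -> C) (n m : nat) (z : C) :
  iter g (n + m) z = iter g n (iter g m z).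
Proof. apply Nat.iter_add. Qed.

(** Real parts are dominated by the orbit of the real number [x], which shrinks
    by the factor [kappa] as long as it exceeds 1. *)
Lemma Re_iter_contract (lam kappa x : R) (k : nat) (z : C) :
  0 < lam -> lam * exp 1 <= 1 -> 1 <= x -> lam * exp x <= kappa * x ->
  0 <= kappa <= 1 -> Re z <= x ->
  Re (iter (fexp lam) k z) <= Rmax 1 (kappa ^ k * x).
Proof.
  intros hl h1 hx hkx hk hz. induction k as [|k IH].
  - simpl. rewrite Rmult_1_l. eapply Rle_trans; [exact hz | apply Rmax_r].
  - change (iter (fexp lam) (S k) z) with (fexp lam (iter (fexp lam) k z)).
    set (w := iter (fexp lam) k z) in *.
    apply Rle_trans with (lam * exp (Re w)).
    { rewrite <- Cmod_fexp by easy. eapply Rle_trans; [apply Rle_abs | apply re_le_Cmod]. }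
    assert (hkk : 0 <= kappa ^ k <= 1).
    { split; [apply pow_le; lra |]. rewrite <- (pow1 k). apply pow_incr; lra. }
    apply Rle_trans with (lam * exp (Rmax 1 (kappa ^ k * x))).
    { apply Rmult_le_compat_l; [lra | apply exp_le_mono; exact IH]. }
    destruct (Rle_dec (kappa ^ k * x) 1) as [h | h].
    + rewrite Rmax_left by easy. eapply Rle_trans; [exact h1 | apply Rmax_l].
    + apply Rnot_le_lt in h. rewrite Rmax_right by lra.
      eapply Rle_trans; [|apply Rmax_r].
      set (y := kappa ^ k * x) in *. simpl pow. rewrite Rmult_assoc. fold y.
      assert (hy : y <= x) by (unfold y; nra).
      pose proof (exp_ratio_le x y ltac:(lra)).
      apply Rmult_le_reg_r with x; [lra |].
      apply Rle_trans with (lam * exp x * y); [nra |]. nra.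
Qed.

(** Left of the line [Re = 1] the map has derivative at most [lam e < 1]. *)
Lemma iter_to_attracting (lam alpha : R) (j : nat) (z : C) :
  0 < lam -> lam * exp 1 < 1 -> 0 <= alpha <= 1 -> lam * exp alpha = alpha ->
  Re z <= 1 -> Cmod z <= 1 ->
  Re (iter (fexp lam) j z) <= 1 /\
  Cmod (iter (fexp lam) j z - RtoC alpha) <= 2 * (lam * exp 1) ^ j.
Proof.
  intros hl h1 ha hfa hz hz'. induction j as [|j [IH1 IH2]].
  - simpl. split; [easy |]. eapply Rle_trans; [apply Cmod_minus_le |].
    rewrite Cmod_R, Rabs_pos_eq; lra.
  - change (iter (fexp lam) (S j) z) with (fexp lam (iter (fexp lam) j z)).
    set (w := iter (fexp lam) j z) in *.
    assert (he : 0 < exp 1) by apply exp_pos.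
    assert (hew : exp (Re w) <= exp 1) by (apply exp_le_mono; easy).
    split.
    + eapply Rle_trans; [eapply Rle_trans; [apply Rle_abs | apply re_le_Cmod] |].
      rewrite Cmod_fexp by easy. nra.
    + assert (e : RtoC alpha = fexp lam (RtoC alpha)).
      { unfold fexp. rewrite Cexp_RtoC, <- RtoC_mult, hfa. easy. }
      rewrite e, fexp_minus, Cmod_mult, <- e, Cmod_R, Rabs_pos_eq by lra.
      pose proof (Cexp_minus_1_le (w - RtoC alpha)) as h.
      assert (hm : alpha * Rmax 1 (exp (Re (w - RtoC alpha))) <= lam * exp 1).
      { rewrite <- RmaxRmult by lra. apply Rmax_lub.
        - rewrite Rmult_1_r, <- hfa. apply Rmult_le_compat_l; [lra |].
          apply exp_le_mono; lra.
        - replace (alpha * exp (Re (w - RtoC alpha)))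
            with (lam * exp (alpha + Re (w - RtoC alpha)))
            by (rewrite exp_plus, <- Rmult_assoc, hfa; easy).
          apply Rmult_le_compat_l; [lra |]. apply exp_le_mono.
          change (Re (w - RtoC alpha)) with (Re w - alpha). lra. }
      simpl. pose proof (Cmod_ge_0 (w - RtoC alpha)).
      apply Rle_trans with
        (alpha * Rmax 1 (exp (Re (w - RtoC alpha))) * Cmod (w - RtoC alpha)).
      { rewrite Rmult_assoc. apply Rmult_le_compat_l; lra. }
      assert (0 <= lam * exp 1) by nra.
      apply Rle_trans with (lam * exp 1 * Cmod (w - RtoC alpha)); [nra |]. nra.
Qed.

Lemma pow_small (q eps : R) :
  0 <= q < 1 -> 0 < eps -> exists N, forall n, (N <= n)%nat -> q ^ n < eps.
Proof.
  intros hq he. destruct (pow_lt_1_zero q ltac:(rewrite Rabs_pos_eq; lra) eps he)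
    as [N h].
  exists N. intros n hn. specialize (h n hn). pose proof (Rle_abs (q ^ n)). lra.
Qed.

(** Any half-plane strictly left of the repelling fixed point enters the
    half-plane left of 1, and from then on it is contracted, at a uniform time. *)
Lemma iter_uniform_attracting (lam alpha x : R) (m : nat) (eps : R) :
  0 < lam -> lam * exp 1 < 1 -> 0 <= alpha <= 1 -> lam * exp alpha = alpha ->
  1 <= x -> lam * exp x < x -> 0 < eps ->
  exists N, forall n, (N <= n)%nat -> forall w, Re (iter (fexp lam) m w) < x ->
    Cmod (iter (fexp lam) n w - RtoC alpha) < eps.
Proof.
  intros hl h1 ha hfa hx hxx he. pose proof (exp_pos 1) as he1.
  pose proof (exp_pos x) as hex.
  set (kappa := lam * exp x / x).
  assert (hkx : kappa * x = lam * exp x) by (unfold kappa; field; lra).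
  assert (hk : 0 <= kappa < 1).
  { split; [unfold kappa; apply Rdiv_le_0_compat; nra |]. nra. }
  destruct (pow_small kappa (/ x) hk ltac:(apply Rinv_0_lt_compat; lra)) as [K hK].
  specialize (hK K ltac:(lia)).
  assert (hK1 : kappa ^ K * x <= 1).
  { apply Rmult_lt_compat_r with (r := x) in hK; [|lra].
    rewrite Rinv_l in hK; lra. }
  destruct (pow_small (lam * exp 1) (eps / 2)) as [J hJ]; [nra | lra |].
  exists (J + (1 + (K + m)))%nat. intros n hn w hw.
  replace n with ((n - (1 + (K + m))) + (1 + (K + m)))%nat by lia.
  rewrite iter_add.
  set (u := iter (fexp lam) (1 + (K + m)) w).
  assert (hu : Cmod u <= 1).
  { unfold u. rewrite (iter_add _ 1 (K + m)). simpl. rewrite Cmod_fexp by easy.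
    assert (hr : Re (iter (fexp lam) (K + m) w) <= 1).
    { rewrite iter_add. eapply Rle_trans.
      - apply (Re_iter_contract lam kappa x K); lra.
      - apply Rmax_lub; lra. }
    apply exp_le_mono in hr. nra. }
  assert (hu' : Re u <= 1).
  { eapply Rle_trans; [apply Rle_abs |]. eapply Rle_trans; [apply re_le_Cmod | easy]. }
  destruct (iter_to_attracting lam alpha (n - (1 + (K + m))) u hl h1 ha hfa hu' hu)
    as [_ h].
  specialize (hJ (n - (1 + (K + m)))%nat ltac:(lia)). lra.
Qed.

Lemma chordal_le (z w : C) : chordal (Some z) (Some w) <= 2 * Cmod (z - w).
Proof.
  unfold chordal. pose proof (Cmod_ge_0 (z - w)).
  assert (h : forall u, 1 <= sqrt (1 + Cmod u ^ 2)).
  { intros u. rewrite <- sqrt_1 at 1. apply sqrt_le_1_alt.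
    pose proof (pow2_ge_0 (Cmod u)). lra. }
  pose proof (h z). pose proof (h w).
  apply Rle_div_l; [nra |].
  assert (1 <= sqrt (1 + Cmod z ^ 2) * sqrt (1 + Cmod w ^ 2)) by nra. nra.
Qed.

(** Either some index recurs along infinitely many terms, and a constant
    subsequence will do, or the indices tend to infinity. *)
Lemma index_dichotomy (i : nat -> nat) :
  (exists v, forall m, exists n, (m < n)%nat /\ i n = v) \/
  (forall B, exists m, forall n, (m <= n)%nat -> (B <= i n)%nat).
Proof.
  destruct (classic (exists v, forall m, exists n, (m < n)%nat /\ i n = v))
    as [h | h]; [now left | right].
  assert (hv : forall v, exists m, forall n, (m < n)%nat -> i n <> v).
  { intros v. apply NNPP. intros hc. apply h. exists v. intros m. apply NNPP.
    intros hm. apply hc. exists m. intros n hn e. apply hm. now exists n. }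
  induction B as [|B [m hm]].
  - exists O. intros; lia.
  - destruct (hv B) as [m' hm']. exists (S (m + m')). intros n hn.
    specialize (hm n ltac:(lia)). specialize (hm' n ltac:(lia)). lia.
Qed.

Lemma recurrent_subsequence (i : nat -> nat) (v : nat) :
  (forall m, exists n, (m < n)%nat /\ i n = v) ->
  exists k : nat -> nat, (forall n, (k n < k (S n))%nat) /\ forall n, i (k n) = v.
Proof.
  intros h.
  set (next := fun m => proj1_sig (constructive_indefinite_description _ (h m))).
  assert (hn : forall m, (m < next m)%nat /\ i (next m) = v).
  { intros m. unfold next. destruct (constructive_indefinite_description _ (h m)). easy. }
  exists (fun n => Nat.iter (S n) next O). split; intros n; simpl; apply hn.
Qed.

(** The half-plane left of [beta] and its preimages belong to the basin of the
    attracting fixed point. *)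
Lemma fatou_of_Re_lt (lam beta : R) (m : nat) (z : C) :
  0 < lam < / exp 1 -> 1 < beta -> lam * exp beta = beta ->
  Re (iter (fexp lam) m z) < beta -> fatou (fexp lam) z.
Proof.
  intros hl hb hfb hz. pose proof (lam_exp1_lt_1 lam hl) as h1.
  destruct (exists_attracting lam hl) as [alpha [ha hfa]].
  exists (fun w => Re (iter (fexp lam) m w) < beta).
  split; [apply open_iter_Re_lt |]. split; [exact hz |]. intros i.
  destruct (index_dichotomy i) as [[v hv] | hi].
  - destruct (recurrent_subsequence i v hv) as [k [hk hkv]].
    exists k. split; [easy |]. exists (fun w => Some (iter (fexp lam) v w)).
    intros w hw. exists (fun _ => True). split; [apply open_true |].
    split; [easy |]. intros eps he. exists O. intros n _ u _ _. rewrite hkv.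
    eapply Rle_lt_trans; [apply chordal_le |].
    replace (_ - _)%C with (RtoC 0) by ring. rewrite Cmod_0. lra.
  - exists (fun n => n). split; [lia |]. exists (fun _ => Some (RtoC alpha)).
    intros w hw.
    set (x := Rmax 1 ((Re (iter (fexp lam) m w) + beta) / 2)).
    assert (hx1 : 1 <= x) by apply Rmax_l.
    assert (hxw : Re (iter (fexp lam) m w) < x).
    { eapply Rlt_le_trans; [| apply Rmax_r]. lra. }
    assert (hxb : x < beta) by (apply Rmax_lub_lt; lra).
    assert (hxx : lam * exp x < x).
    { pose proof (exp_ratio_lt beta x ltac:(lra)). nra. }
    exists (fun u => Re (iter (fexp lam) m u) < x).
    split; [apply open_iter_Re_lt |]. split; [easy |]. intros eps he.
    destruct (iter_uniform_attracting lam alpha x m (eps / 2)) as [N hN]; try lra.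
    destruct (hi N) as [M hM]. exists M. intros n hn u _ hu.
    eapply Rle_lt_trans; [apply chordal_le |].
    specialize (hN (i n) (hM n hn) u hu). lra.
Qed.

(** * Orbits on a hair *)

Lemma trig_period_Z (x : R) (k : Z) :
  cos (x - 2 * IZR k * PI) = cos x /\ sin (x - 2 * IZR k * PI) = sin x.
Proof.
  destruct (Z_le_dec 0 k) as [h | h].
  - rewrite <- (Z2Nat.id k h), <- INR_IZR_INZ. set (n := Z.to_nat k).
    split; [rewrite <- (cos_period (x - _) n) | rewrite <- (sin_period (x - _) n)];
      f_equal; ring.
  - replace k with (- (- k))%Z by lia. rewrite opp_IZR.
    rewrite <- (Z2Nat.id (- k)) by lia. rewrite <- INR_IZR_INZ.
    set (n := Z.to_nat (- k)).
    replace (x - 2 * - INR n * PI) with (x + 2 * INR n * PI) by ring.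
    split; [apply cos_period | apply sin_period].
Qed.

Lemma Rabs_lt_PI2 (y : R) : - PI < y <= PI -> 0 < cos y -> Rabs y < PI / 2.
Proof.
  intros hy hc. pose proof PI_RGT_0. apply Rabs_lt_between. split.
  - apply Rnot_le_lt. intros h. rewrite <- cos_neg in hc.
    pose proof (cos_le_0 (- y) ltac:(lra) ltac:(lra)). lra.
  - apply Rnot_le_lt. intros h. pose proof (cos_le_0 y ltac:(lra) ltac:(lra)). lra.
Qed.

Lemma Rabs_mult_cos_le_sin (y : R) :
  Rabs y < PI / 2 -> Rabs y * cos y <= Rabs (sin y).
Proof.
  intros hy. apply Rabs_lt_between in hy. pose proof PI_RGT_0.
  destruct (MVT_gen sin 0 y cos) as [c [hc1 hc]].
  - intros; auto_derive; auto; ring.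
  - intros; apply continuity_sin.
  - rewrite sin_0, !Rminus_0_r in hc. rewrite hc, Rabs_mult, Rmult_comm.
    apply Rmult_le_compat_r; [apply Rabs_pos |].
    eapply Rle_trans; [|apply Rle_abs].
    destruct (Rle_dec 0 y) as [h | h].
    + rewrite Rmin_left, Rmax_right in hc1 by lra. apply cos_decr_1; lra.
    + rewrite Rmin_right, Rmax_left in hc1 by lra.
      rewrite <- (cos_neg c), <- (cos_neg y). apply cos_decr_1; lra.
Qed.

Definition itinerary (lam beta : R) (s : nat -> Z) (z : C) : Prop :=
  forall n, beta <= Re (iter (fexp lam) n z) /\ strip (s n) (iter (fexp lam) n z).

Lemma itinerary_of_hair (lam beta : R) (s : nat -> Z) (z : C) :
  0 < lam < / exp 1 -> 1 < beta -> lam * exp beta = beta ->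
  hair lam s z -> itinerary lam beta s z.
Proof.
  intros hl hb hfb [hj ha] n. split; [|apply ha].
  apply Rnot_lt_le. intros h. apply hj. now apply (fatou_of_Re_lt lam beta n).
Qed.

Lemma iter_S (g : C -> C) (n : nat) (z : C) : iter g (S n) z = g (iter g n z).
Proof. reflexivity. Qed.

(** The offset of [Im z] within its strip is the principal argument of the
    image point. *)
Lemma fexp_polar (lam : R) (k : Z) (z : C) :
  0 < lam -> strip k z -> 0 < Re (fexp lam z) ->
  let y := Im z - 2 * IZR k * PI in
  Rabs y < PI / 2 /\ Re (fexp lam z) = Cmod (fexp lam z) * cos y /\
  Im (fexp lam z) = Cmod (fexp lam z) * sin y.
Proof.
  intros hl hs hr y.
  destruct (trig_period_Z (Im z) k) as [hc hsn]. fold y in hc, hsn.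
  assert (e1 : Re (fexp lam z) = Cmod (fexp lam z) * cos y).
  { rewrite Cmod_fexp by easy. unfold fexp, Cexp, Cmult, RtoC. simpl.
    rewrite hc. ring. }
  assert (e2 : Im (fexp lam z) = Cmod (fexp lam z) * sin y).
  { rewrite Cmod_fexp by easy. unfold fexp, Cexp, Cmult, RtoC. simpl.
    rewrite hsn. ring. }
  split; [|split; assumption].
  apply Rabs_lt_PI2.
  - unfold y. unfold strip in hs. lra.
  - pose proof (Cmod_ge_0 (fexp lam z)). nra.
Qed.

Lemma strip_offset_le (lam : R) (k : Z) (z : C) :
  0 < lam -> strip k z -> 0 < Re (fexp lam z) ->
  Rabs (Im z - 2 * IZR k * PI) * Re (fexp lam z) <= Rabs (Im (fexp lam z)).
Proof.
  intros hl hs hr. destruct (fexp_polar lam k z hl hs hr) as [h1 [h2 h3]].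
  rewrite h2, h3, Rabs_mult, (Rabs_pos_eq (Cmod _)) by apply Cmod_ge_0.
  pose proof (Rabs_mult_cos_le_sin _ h1). pose proof (Cmod_ge_0 (fexp lam z)). nra.
Qed.

Lemma strip_offset_ge (lam : R) (k : Z) (z : C) :
  0 < lam -> strip k z -> 0 < Re (fexp lam z) ->
  Rabs (Im (fexp lam z)) <= Cmod (fexp lam z) * Rabs (Im z - 2 * IZR k * PI).
Proof.
  intros hl hs hr. destruct (fexp_polar lam k z hl hs hr) as [h1 [h2 h3]].
  rewrite h3, Rabs_mult, (Rabs_pos_eq (Cmod _)) by apply Cmod_ge_0.
  apply Rmult_le_compat_l; [apply Cmod_ge_0 | apply Rabs_sin_le].
Qed.

Lemma strip_Im_minus (k : Z) (z w : C) :
  strip k z -> strip k w -> Rabs (Im z - Im w) <= 2 * PI.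
Proof. unfold strip. intros. apply Rabs_le. lra. Qed.

Lemma strip_Im_ge_PI (k : Z) (z : C) : k <> 0%Z -> strip k z -> PI <= Rabs (Im z).
Proof.
  unfold strip. intros hk h. pose proof PI_RGT_0.
  destruct (Z_le_dec 1 k) as [h1 | h1].
  - apply IZR_le in h1. eapply Rle_trans; [|apply Rle_abs]. nra.
  - assert (h2 : (k <= -1)%Z) by lia. apply IZR_le in h2.
    rewrite <- Rabs_Ropp. eapply Rle_trans; [|apply Rle_abs]. nra.
Qed.

(** On the half-plane right of [beta] the principal logarithm, here written in
    real coordinates, has derivative at most [1 / beta], and the half-plane is
    convex. *)
Lemma log_lipschitz (beta x1 y1 x2 y2 : R) :
  0 < beta -> beta <= x1 -> beta <= x2 ->
  let A := ln (x2 ^ 2 + y2 ^ 2) / 2 - ln (x1 ^ 2 + y1 ^ 2) / 2 in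
  let B := atan (y2 / x2) - atan (y1 / x1) in
  beta ^ 2 * (A ^ 2 + B ^ 2) <= (x2 - x1) ^ 2 + (y2 - y1) ^ 2.
Proof.
  intros hb h1 h2 A B.
  assert (hpos : forall u v, 0 < u -> 0 < u ^ 2 + v ^ 2) by (intros; nra).
  set (dx := x2 - x1). set (dy := y2 - y1).
  set (X := fun t => x1 + t * dx). set (Y := fun t => y1 + t * dy).
  set (P := fun t => (X t * dx + Y t * dy) / (X t ^ 2 + Y t ^ 2)).
  set (Q := fun t => (X t * dy - Y t * dx) / (X t ^ 2 + Y t ^ 2)).
  assert (hX : forall t, 0 <= t <= 1 -> beta <= X t).
  { intros t ht. unfold X, dx. nra. }
  set (h := fun t => A * (ln (X t ^ 2 + Y t ^ 2) / 2) + B * atan (Y t / X t)).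
  assert (hd : forall t, 0 <= t <= 1 -> is_derive h t (A * P t + B * Q t)).
  { intros t ht. specialize (hX t ht). unfold h, P, Q, X, Y in *.
    auto_derive.
    - split; [|split; [lra | easy]]. apply (hpos (x1 + t * dx)). lra.
    - field. split; [|lra]. apply Rgt_not_eq. apply hpos; lra. }
  destruct (MVT_gen h 0 1 (fun t => A * P t + B * Q t)) as [t [ht e]].
  - rewrite Rmin_left, Rmax_right by lra. intros t ht. apply hd. lra.
  - rewrite Rmin_left, Rmax_right by lra. intros t ht.
    apply derivable_continuous_pt. exists (A * P t + B * Q t).
    apply is_derive_Reals, hd, ht.
  - rewrite Rmin_left, Rmax_right in ht by lra.
    assert (e2 : h 1 - h 0 = A ^ 2 + B ^ 2).
    { unfold h, X, Y.
      replace (x1 + 1 * dx) with x2 by (unfold dx; ring).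
      replace (y1 + 1 * dy) with y2 by (unfold dy; ring).
      replace (x1 + 0 * dx) with x1 by ring. replace (y1 + 0 * dy) with y1 by ring.
      assert (eA : ln (x2 ^ 2 + y2 ^ 2) / 2 = A + ln (x1 ^ 2 + y1 ^ 2) / 2)
        by (unfold A; ring).
      assert (eB : atan (y2 / x2) = B + atan (y1 / x1)) by (unfold B; ring).
      rewrite eA, eB. ring. }
    rewrite e2, Rminus_0_r, Rmult_1_r in e.
    specialize (hX t ht).
    assert (hn : 0 < X t ^ 2 + Y t ^ 2) by nra.
    assert (e3 : (P t ^ 2 + Q t ^ 2) * (X t ^ 2 + Y t ^ 2) = dx ^ 2 + dy ^ 2).
    { unfold P, Q. field. lra. }
    assert (hPQ : beta ^ 2 * (P t ^ 2 + Q t ^ 2) <= dx ^ 2 + dy ^ 2).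
    { rewrite <- e3. rewrite Rmult_comm. apply Rmult_le_compat_l; nra. }
    assert (A ^ 2 + B ^ 2 <= P t ^ 2 + Q t ^ 2).
    { pose proof (pow2_ge_0 (A - P t)). pose proof (pow2_ge_0 (B - Q t)). nra. }
    eapply Rle_trans; [|exact hPQ]. apply Rmult_le_compat_l; [nra | easy].
Qed.

Lemma ln_Cmod_fexp (lam : R) (z : C) : 0 < lam ->
  ln (Re (fexp lam z) ^ 2 + Im (fexp lam z) ^ 2) / 2 = ln lam + Re z.
Proof.
  intros hl.
  assert (e : Re (fexp lam z) ^ 2 + Im (fexp lam z) ^ 2 = (lam * exp (Re z)) ^ 2).
  { rewrite <- Cmod_fexp by easy. symmetry. apply Cmod2_alt. }
  rewrite e. pose proof (exp_pos (Re z)).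
  simpl. rewrite Rmult_1_r, ln_mult, ln_mult, ln_exp by nra. field.
Qed.

Lemma atan_fexp (lam : R) (k : Z) (z : C) :
  0 < lam -> strip k z -> 0 < Re (fexp lam z) ->
  atan (Im (fexp lam z) / Re (fexp lam z)) = Im z - 2 * IZR k * PI.
Proof.
  intros hl hs hr. destruct (fexp_polar lam k z hl hs hr) as [h1 [h2 h3]].
  set (y := Im z - 2 * IZR k * PI) in *.
  assert (hm : 0 < Cmod (fexp lam z)).
  { rewrite Cmod_fexp by easy. pose proof (exp_pos (Re z)). nra. }
  assert (0 < cos y) by nra.
  rewrite h2, h3. replace (_ / _) with (tan y) by (unfold tan; field; lra).
  apply atan_tan. apply Rabs_lt_between in h1. lra.
Qed.

(** Inverse branches of [fexp lam] are logarithms, to which [log_lipschitz]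
    applies. *)
Lemma fexp_expanding (lam beta : R) (k : Z) (z w : C) :
  0 < lam -> 0 < beta -> strip k z -> strip k w ->
  beta <= Re (fexp lam z) -> beta <= Re (fexp lam w) ->
  beta * Cmod (z - w) <= Cmod (fexp lam z - fexp lam w).
Proof.
  intros hl hb hz hw hz' hw'.
  pose proof (log_lipschitz beta _ (Im (fexp lam w)) _ (Im (fexp lam z)) hb hw' hz')
    as h. cbv zeta in h.
  rewrite !ln_Cmod_fexp in h by easy.
  rewrite (atan_fexp lam k z), (atan_fexp lam k w) in h by (easy || lra).
  apply Rsqr_incr_0_var; [|apply Cmod_ge_0]. rewrite !Rsqr_pow2.
  rewrite Rpow_mult_distr, !Cmod2_alt.
  change (Re (fexp lam z - fexp lam w)) with (Re (fexp lam z) - Re (fexp lam w)).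
  change (Im (fexp lam z - fexp lam w)) with (Im (fexp lam z) - Im (fexp lam w)).
  change (Re (z - w)) with (Re z - Re w). change (Im (z - w)) with (Im z - Im w).
  eapply Rle_trans; [|exact h]. right. ring.
Qed.

Lemma itinerary_separation (lam beta : R) (s : nat -> Z) (z w : C) (n : nat) :
  0 < lam -> 0 < beta -> itinerary lam beta s z -> itinerary lam beta s w ->
  beta ^ n * Cmod (z - w) <= Cmod (iter (fexp lam) n z - iter (fexp lam) n w).
Proof.
  intros hl hb hz hw. induction n as [|n IH]; [simpl; lra |].
  rewrite !iter_S.
  eapply Rle_trans; [|apply (fexp_expanding lam beta (s n)); try easy].
  - simpl. rewrite Rmult_assoc. apply Rmult_le_compat_l; lra.
  - apply hz.
  - apply hw.
  - apply (hz (S n)).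
  - apply (hw (S n)).
Qed.

Definition escaping (lam : R) (z : C) : Prop :=
  forall B, exists N, forall n, (N <= n)%nat -> B <= Re (iter (fexp lam) n z).

Lemma pow_large (b B : R) : 1 < b -> exists N, forall n, (N <= n)%nat -> B <= b ^ n.
Proof.
  intros hb. destruct (Pow_x_infinity b ltac:(rewrite Rabs_pos_eq; lra) B) as [N h].
  exists N. intros n hn. specialize (h n hn).
  rewrite Rabs_pos_eq in h by (apply pow_le; lra). lra.
Qed.

(** A point that is 4 units to the right of another one on the same hair has a
    much larger image, and as the imaginary parts of the two images differ by at
    most [2 PI], it is the real part that must account for this. *)
Lemma lead_persists (lam beta : R) (s : nat -> Z) (z w : C) (n : nat) :
  0 < lam -> 1 < beta -> itinerary lam beta s z -> itinerary lam beta s w ->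
  4 <= Re (iter (fexp lam) n z) - Re (iter (fexp lam) n w) ->
  Re (iter (fexp lam) (S n) w) <= Re (iter (fexp lam) (S n) z).
Proof.
  intros hl hb hz hw h. apply Rnot_lt_le. intros hc.
  destruct (hz (S n)) as [hz1 hz2]. destruct (hw (S n)) as [hw1 hw2].
  pose proof (strip_Im_minus _ _ _ hz2 hw2) as hIm.
  rewrite !iter_S in *.
  set (zn := iter (fexp lam) n z) in *. set (wn := iter (fexp lam) n w) in *.
  assert (h16 : 16 * Cmod (fexp lam wn) <= Cmod (fexp lam zn)).
  { rewrite !Cmod_fexp by easy.
    replace (Re zn) with ((Re zn - Re wn) + Re wn) by ring. rewrite exp_plus.
    assert (16 <= exp (Re zn - Re wn)).
    { apply exp_ge_16. lra. }
    pose proof (exp_pos (Re wn)).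
    replace (16 * (lam * exp (Re wn))) with (lam * (16 * exp (Re wn))) by ring.
    apply Rmult_le_compat_l; [lra |]. apply Rmult_le_compat_r; lra. }
  pose proof (Cmod_le_abs (fexp lam zn)) as h1.
  pose proof (re_le_Cmod (fexp lam wn)) as h2. pose proof (Rle_abs (Re (fexp lam wn))).
  pose proof (im_le_Cmod (fexp lam wn)) as h3.
  rewrite (Rabs_pos_eq (Re (fexp lam zn))) in h1 by lra.
  assert (Rabs (Im (fexp lam zn)) <= Rabs (Im (fexp lam wn)) + 2 * PI).
  { replace (Im (fexp lam zn))
      with (Im (fexp lam wn) + (Im (fexp lam zn) - Im (fexp lam wn))) by ring.
    eapply Rle_trans; [apply Rabs_triang |]. lra. }
  pose proof PI_4. lra.
Qed.

Lemma escaping_of_lead (lam beta : R) (s : nat -> Z) (z w : C) (n0 : nat) :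
  0 < lam -> 1 < beta -> itinerary lam beta s z -> itinerary lam beta s w ->
  z <> w ->
  (forall n, (n0 <= n)%nat ->
     4 <= Rabs (Re (iter (fexp lam) n z) - Re (iter (fexp lam) n w))) ->
  0 <= Re (iter (fexp lam) n0 z) - Re (iter (fexp lam) n0 w) ->
  escaping lam z.
Proof.
  intros hl hb hz hw hne h h0.
  assert (H : forall n, (n0 <= n)%nat ->
    0 <= Re (iter (fexp lam) n z) - Re (iter (fexp lam) n w)).
  { intros n hn. induction hn as [|n hn IH]; [exact h0 |].
    specialize (h n hn). rewrite Rabs_pos_eq in h by exact IH.
    pose proof (lead_persists lam beta s z w n hl hb hz hw h). lra. }
  assert (hd : 0 < Cmod (z - w)).
  { apply Cmod_gt_0. intros e. apply hne.
    replace z with ((z - w) + w)%C by ring. rewrite e. ring. }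
  intros B. destruct (pow_large beta ((Rabs B + 2 * PI) / Cmod (z - w)) hb) as [N hN].
  exists (N + n0)%nat. intros n hn. specialize (hN n ltac:(lia)).
  apply Rle_div_l in hN; [|easy].
  pose proof (itinerary_separation lam beta s z w n hl ltac:(lra) hz hw) as hs.
  pose proof (Cmod_le_abs (iter (fexp lam) n z - iter (fexp lam) n w)) as ha.
  change (Re (iter (fexp lam) n z - iter (fexp lam) n w))
    with (Re (iter (fexp lam) n z) - Re (iter (fexp lam) n w)) in ha.
  change (Im (iter (fexp lam) n z - iter (fexp lam) n w))
    with (Im (iter (fexp lam) n z) - Im (iter (fexp lam) n w)) in ha.
  pose proof (strip_Im_minus _ _ _ (proj2 (hz n)) (proj2 (hw n))).
  rewrite (Rabs_pos_eq (Re _ - Re _)) in ha by (apply H; lia).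
  pose proof (proj1 (hw n)). pose proof (Rle_abs B). lra.
Qed.

(** At most one point of a hair fails to escape, since orbits separate
    exponentially fast while the strip keeps their imaginary parts together. *)
Lemma escaping_or (lam beta : R) (s : nat -> Z) (z w : C) :
  0 < lam -> 1 < beta -> itinerary lam beta s z -> itinerary lam beta s w ->
  z <> w -> escaping lam z \/ escaping lam w.
Proof.
  intros hl hb hz hw hne.
  assert (hd : 0 < Cmod (z - w)).
  { apply Cmod_gt_0. intros e. apply hne.
    replace z with ((z - w) + w)%C by ring. rewrite e. ring. }
  destruct (pow_large beta ((4 + 2 * PI) / Cmod (z - w)) hb) as [N hN].
  assert (H : forall n, (N <= n)%nat ->
     4 <= Rabs (Re (iter (fexp lam) n z) - Re (iter (fexp lam) n w))).
  { intros n hn. specialize (hN n hn). apply Rle_div_l in hN; [|easy].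
    pose proof (itinerary_separation lam beta s z w n hl ltac:(lra) hz hw) as hs.
    pose proof (Cmod_le_abs (iter (fexp lam) n z - iter (fexp lam) n w)) as ha.
    pose proof (strip_Im_minus _ _ _ (proj2 (hz n)) (proj2 (hw n))).
    change (Re (iter (fexp lam) n z - iter (fexp lam) n w))
      with (Re (iter (fexp lam) n z) - Re (iter (fexp lam) n w)) in ha.
    change (Im (iter (fexp lam) n z - iter (fexp lam) n w))
      with (Im (iter (fexp lam) n z) - Im (iter (fexp lam) n w)) in ha.
    lra. }
  destruct (Rle_dec 0 (Re (iter (fexp lam) N z) - Re (iter (fexp lam) N w)))
    as [h | h].
  - left. now apply (escaping_of_lead lam beta s z w N).
  - right. apply (escaping_of_lead lam beta s w z N); try easy.
    + intros n hn. rewrite Rabs_minus_sym. now apply H.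
    + lra.
Qed.

(** In the strip around the real axis the imaginary parts of an orbit grow by
    the factor [beta], so only real points can stay there. *)
Lemma itinerary_eventually_0_real (lam beta : R) (s : nat -> Z) (z : C) (n : nat) :
  0 < lam -> 1 < beta -> itinerary lam beta s z ->
  (forall m, (n <= m)%nat -> s m = 0%Z) -> Im (iter (fexp lam) n z) = 0.
Proof.
  intros hl hb hz hs.
  assert (H : forall j, beta ^ j * Rabs (Im (iter (fexp lam) n z))
    <= Rabs (Im (iter (fexp lam) (j + n) z))).
  { induction j as [|j IH]; [simpl; lra |].
    destruct (hz (j + n)%nat) as [_ h1]. destruct (hz (S j + n)%nat) as [h2 _].
    change (S j + n)%nat with (S (j + n)) in *. rewrite !iter_S in *.
    pose proof (strip_offset_le lam _ _ hl h1 ltac:(lra)) as h3.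
    rewrite hs in h3 by lia. simpl pow.
    replace (Im (iter (fexp lam) (j + n) z) - 2 * 0 * PI)
      with (Im (iter (fexp lam) (j + n) z)) in h3 by ring.
    pose proof (Rabs_pos (Im (iter (fexp lam) (j + n) z))). nra. }
  apply NNPP. intros hne. pose proof (Rabs_pos_lt _ hne) as hp.
  destruct (pow_large beta ((PI + 1) / Rabs (Im (iter (fexp lam) n z))) hb) as [N hN].
  specialize (hN N ltac:(lia)). apply Rle_div_l in hN; [|easy].
  specialize (H N). destruct (hz (N + n)%nat) as [_ h]. rewrite hs in h by lia.
  unfold strip in h.
  assert (Rabs (Im (iter (fexp lam) (N + n) z)) <= PI) by (apply Rabs_le; lra).
  lra.
Qed.

Lemma is_derive_fexp (lam : R) (z : C) :
  @is_derive C_AbsRing C_NormedModule (fexp lam) z (fexp lam z).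
Proof.
  split; [apply is_linear_scal_l |].
  intros x hx.
  apply (@is_filter_lim_locally_unique _ (AbsRing_NormedModule C_AbsRing)) in hx.
  subst x. intros eps.
  set (c := Cmod (fexp lam z)). assert (hc : 0 <= c) by apply Cmod_ge_0.
  assert (hd : 0 < Rmin (1 / 2) (eps / (4 * c + 1))).
  { apply Rmin_glb_lt; [lra |]. apply Rdiv_lt_0_compat; [apply cond_pos | lra]. }
  exists (mkposreal _ hd). intros w hw.
  change (Cmod (w - z) < Rmin (1 / 2) (eps / (4 * c + 1))) in hw.
  change (Cmod ((fexp lam w - fexp lam z) - (w - z) * fexp lam z)
    <= eps * Cmod (w - z)).
  rewrite fexp_minus.
  replace (fexp lam z * (Cexp (w - z) - 1) - (w - z) * fexp lam z)%C
    with (fexp lam z * (Cexp (w - z) - 1 - (w - z)))%C by ring.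
  rewrite Cmod_mult. fold c.
  assert (h1 : Cmod (w - z) < 1 / 2) by (eapply Rlt_le_trans; [exact hw | apply Rmin_l]).
  assert (h2 : Cmod (w - z) < eps / (4 * c + 1))
    by (eapply Rlt_le_trans; [exact hw | apply Rmin_r]).
  apply Rlt_div_r in h2; [|lra].
  pose proof (Cexp_Taylor1_le (w - z) ltac:(lra)) as hT.
  pose proof (Cmod_ge_0 (w - z)).
  apply Rle_trans with (c * (4 * Cmod (w - z) ^ 2)).
  - apply Rmult_le_compat_l; easy.
  - nra.
Qed.

(** Were the address eventually 0, the [n]-th image of the hair would be real and
    right of [beta], which is what triviality means. *)
Lemma nontrivial_address (lam beta : R) (s : nat -> Z) :
  0 < lam < / exp 1 -> 1 < beta -> lam * exp beta = beta ->
  ~ trivial_hair lam s -> forall n, exists m, (n <= m)%nat /\ s m <> 0%Z.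
Proof.
  intros hl hb hfb hnt n. apply NNPP. intros hc. apply hnt.
  assert (e : fexp lam (RtoC beta) = RtoC beta).
  { unfold fexp. rewrite Cexp_RtoC, <- RtoC_mult, hfb. easy. }
  exists beta. split.
  - split; [exact e |]. exists (fexp lam (RtoC beta)).
    split; [apply is_derive_fexp |]. rewrite e, Cmod_R, Rabs_pos_eq; lra.
  - exists n. intros z hz.
    pose proof (itinerary_of_hair lam beta s z hl hb hfb hz) as hi.
    exists (Re (iter (fexp lam) n z)). split; [apply hi |].
    apply injective_projections; [reflexivity |].
    apply (itinerary_eventually_0_real lam beta s); try easy.
    intros m hm. apply NNPP. intros h. apply hc. now exists m.
Qed.

(** * Real analytic curves *)

Fixpoint trunc (c : nat -> C) (n : nat) : list C :=
  match n with O => nil | S m => c O :: trunc (fun k => c (S k)) m end.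

Lemma peval_trunc_add (c : nat -> C) (n m : nat) (w : R) :
  peval (trunc c (n + m)) w =
  (peval (trunc c n) w + RtoC (w ^ n) * peval (trunc (fun k => c (n + k)%nat) m) w)%C.
Proof.
  revert c. induction n as [|n IH]; intros c.
  - simpl. change (fun k => c k) with c. ring.
  - simpl. rewrite IH, RtoC_mult. simpl. ring.
Qed.

Lemma peval_trunc_sum_n (c : nat -> C) (n : nat) (w : R) :
  sum_n (fun k => @scal R_AbsRing C_R_NormedModule (pow_n w k) (c k)) n
  = peval (trunc c (S n)) w.
Proof.
  assert (e : forall k, @scal R_AbsRing C_R_NormedModule (pow_n w k) (c k)
    = (RtoC (w ^ k) * c k)%C).
  { intros k. rewrite pow_n_pow. destruct (c k) as [x y].
    apply injective_projections; simpl; unfold scal; simpl; unfold mult; simpl; ring. }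
  induction n as [|n IH].
  - rewrite sum_O, e. simpl. ring.
  - rewrite sum_Sn, IH, e. rewrite <- (Nat.add_1_r (S n)), peval_trunc_add.
    simpl trunc at 3. simpl (peval (_ :: nil) w). rewrite Nat.add_0_r.
    change (@plus _) with Cplus. f_equal. ring.
Qed.

Lemma norm_C_R (z : C) : @norm R_AbsRing C_R_NormedModule z = Cmod z.
Proof.
  destruct z as [x y]. unfold Cmod. simpl fst; simpl snd.
  rewrite <- (pow2_abs x), <- (pow2_abs y).
  unfold norm. simpl. unfold prod_norm. simpl. unfold norm. simpl. unfold abs.
  simpl. reflexivity.
Qed.

Lemma pnorm_trunc_le (c : nat -> C) (K rho r : R) (n : nat) :
  0 < rho -> 0 <= r <= rho / 2 -> (forall k, Cmod (c k) * rho ^ k <= K) ->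
  pnorm r (trunc c n) <= 2 * K.
Proof.
  intros hrho hr. revert c K. induction n as [|n IH]; intros c K hc.
  - simpl. specialize (hc O). pose proof (Cmod_ge_0 (c O)). simpl in hc. lra.
  - simpl. assert (h := IH (fun k => c (S k)) (K / rho)).
    assert (h' : pnorm r (trunc (fun k => c (S k)) n) <= 2 * (K / rho)).
    { apply h. intros k. specialize (hc (S k)). simpl in hc.
      apply (proj1 (Rle_div_r _ _ _ hrho)). lra. }
    pose proof (hc O) as h0. simpl in h0.
    assert (hK : 0 <= K / rho).
    { apply Rdiv_le_0_compat; [|easy]. pose proof (Cmod_ge_0 (c O)). lra. }
    assert (r * pnorm r (trunc (fun k => c (S k)) n) <= rho / 2 * (2 * (K / rho))).
    { apply Rle_trans with (r * (2 * (K / rho))).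
      - apply Rmult_le_compat_l; lra.
      - apply Rmult_le_compat_r; lra. }
    replace (rho / 2 * (2 * (K / rho))) with K in H by (field; lra). lra.
Qed.

(** [d] is the derivative of [phi] at [t0], with a quadratic error term whose
    own Taylor coefficients are controlled on all small discs. *)
Definition analytic_jet (phi : R -> C) (t0 : R) (d : C) (K r0 : R) : Prop :=
  forall r, 0 <= r <= r0 ->
    l1ball r (K * r ^ 2) (fun w : R => phi (t0 + w)%R - phi t0 - d * w)%C.

(** The terms of a power series converging at distance [rho] are bounded there,
    so on discs of radius at most [rho / 2] geometric series control both the
    norm of the quadratic part and the truncation error. *)
Lemma real_analytic_jet (a b : R) (phi : R -> C) (t0 : R) :
  real_analytic a b phi -> a < t0 < b ->
  exists d K r0, 0 < r0 /\ a < t0 - r0 /\ t0 + r0 < b /\ 0 <= K /\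
    analytic_jet phi t0 d K r0.
Proof.
  intros ha ht. destruct (ha t0 ht) as [c [r1 [hr1 hs]]].
  set (rho := Rmin r1 (Rmin (t0 - a) (b - t0)) / 2).
  assert (hrho : 0 < rho /\ 2 * rho <= r1 /\ 2 * rho <= t0 - a /\ 2 * rho <= b - t0).
  { unfold rho.
    assert (0 < Rmin r1 (Rmin (t0 - a) (b - t0))) by (repeat apply Rmin_glb_lt; lra).
    pose proof (Rmin_l r1 (Rmin (t0 - a) (b - t0))).
    pose proof (Rmin_r r1 (Rmin (t0 - a) (b - t0))).
    pose proof (Rmin_l (t0 - a) (b - t0)). pose proof (Rmin_r (t0 - a) (b - t0)). lra. }
  destruct hrho as [hrho [hrho1 [hrho2 hrho3]]]. clearbody rho.
  assert (hcv : forall w, Rabs w <= rho -> forall eps, 0 < eps ->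
    exists N, forall n, (N <= n)%nat ->
      Cmod (phi (t0 + w) - peval (trunc c n) w) < eps).
  { intros w hw eps he. apply Rabs_le_between in hw.
    assert (h : @is_pseries R_AbsRing C_R_NormedModule c ((t0 + w) - t0) (phi (t0 + w))).
    { apply hs; [lra |]. apply Rabs_lt_between. lra. }
    replace ((t0 + w) - t0) with w in h by ring.
    assert (he2 : 0 < eps / 2) by lra.
    destruct (proj1 (filterlim_locally _ _) h (mkposreal _ he2)) as [N hN].
    exists (S N). intros n hn. destruct n as [|n]; [lia |].
    specialize (hN n ltac:(lia)). rewrite peval_trunc_sum_n in hN.
    destruct hN as [h1 h2].
    change (Rabs (Re (peval (trunc c (S n)) w) - Re (phi (t0 + w))) < eps / 2) in h1.
    change (Rabs (Im (peval (trunc c (S n)) w) - Im (phi (t0 + w))) < eps / 2) in h2.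
    rewrite Cmod_sym. eapply Rle_lt_trans; [apply Cmod_le_abs |].
    change (Rabs (Re (peval (trunc c (S n)) w) - Re (phi (t0 + w)))
      + Rabs (Im (peval (trunc c (S n)) w) - Im (phi (t0 + w))) < eps). lra. }
  assert (hB : exists B, forall k, Cmod (c k) * rho ^ k <= B).
  { assert (hl : @is_pseries R_AbsRing C_R_NormedModule c ((t0 + rho) - t0) (phi (t0 + rho))).
    { apply hs; [lra |]. apply Rabs_lt_between. lra. }
    replace ((t0 + rho) - t0) with rho in hl by ring.
    destruct (@filterlim_bounded R_AbsRing C_R_NormedModule _ (ex_intro _ _ hl)) as [B hB].
    assert (hB' : forall n, Cmod (peval (trunc c n) rho) <= B).
    { intros [|n].
      - simpl. rewrite Cmod_0. exact (Rle_trans _ _ _ (norm_ge_0 _) (hB O)).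
      - specialize (hB n). rewrite peval_trunc_sum_n in hB.
        rewrite <- norm_C_R. exact hB. }
    exists (2 * B). intros k.
    assert (e : (RtoC (rho ^ k) * c k)%C
      = (peval (trunc c (k + 1)) rho - peval (trunc c k) rho)%C).
    { rewrite peval_trunc_add. simpl. rewrite Nat.add_0_r. ring. }
    rewrite <- (Rabs_pos_eq (rho ^ k)) by (apply pow_le; lra).
    rewrite <- Cmod_R, Rmult_comm, <- Cmod_mult, e.
    eapply Rle_trans; [apply Cmod_minus_le |].
    pose proof (hB' k). pose proof (hB' (k + 1)%nat). lra. }
  destruct hB as [B hB].
  assert (hB0 : 0 <= B).
  { specialize (hB O). simpl in hB. pose proof (Cmod_ge_0 (c O)). lra. }
  assert (hK : forall n k, Cmod (c (n + k)%nat) * rho ^ k <= B / rho ^ n).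
  { intros n k. apply (proj1 (Rle_div_r _ _ _ (pow_lt rho n hrho))).
    eapply Rle_trans; [|apply (hB (n + k)%nat)]. right. rewrite pow_add. ring. }
  assert (J : forall r, 0 <= r <= rho / 2 ->
    l1ball r (2 * (B / rho ^ 2) * r ^ 2)
      (fun w : R => phi (t0 + w)%R - c 0%nat - c 1%nat * w)%C).
  { intros r hr eps he.
    destruct (pow_small (1 / 2) (eps / (4 * B + 2))) as [n hn];
      [lra | apply Rdiv_lt_0_compat; lra |].
    specialize (hn n (le_n n)). apply Rlt_div_r in hn; [|lra].
    exists (RtoC 0 :: RtoC 0 :: trunc (fun k => c (2 + k)%nat) n). split.
    - pose proof (pnorm_trunc_le (fun k => c (2 + k)%nat) _ rho r n hrho hr (hK 2%nat))
        as h.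
      change (Cmod 0 + r * (Cmod 0 + r * pnorm r (trunc (fun k => c (2 + k)%nat) n))
        <= 2 * (B / rho ^ 2) * r ^ 2).
      rewrite Cmod_0. pose proof (pow2_ge_0 r).
      apply Rle_trans with (pnorm r (trunc (fun k => c (2 + k)%nat) n) * r ^ 2).
      { right. ring. }
      apply Rmult_le_compat_r; easy.
    - intros w hw.
      destruct (hcv w ltac:(lra) (eps / 2) ltac:(lra)) as [N hN].
      specialize (hN ((2 + n) + N)%nat ltac:(lia)).
      rewrite peval_trunc_add in hN.
      set (tail := peval (trunc (fun k => c (2 + n + k)%nat) N) w) in *.
      assert (e : peval (trunc c (2 + n)) w =
        (c 0%nat + c 1%nat * w +
         peval (RtoC 0 :: RtoC 0 :: trunc (fun k => c (2 + k)%nat) n) w)%C).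
      { simpl. ring. }
      rewrite e in hN.
      match goal with |- Cmod ?x <= _ =>
        replace x with ((phi (t0 + w)%R - (c 0%nat + c 1%nat * w +
         peval (RtoC 0 :: RtoC 0 :: trunc (fun k => c (2 + k)%nat) n) w +
         RtoC (w ^ (2 + n)) * tail)) + RtoC (w ^ (2 + n)) * tail)%C by ring end.
      eapply Rle_trans; [apply Cmod_triangle |].
      assert (ht' : Cmod tail <= 2 * (B / rho ^ (2 + n))).
      { eapply Rle_trans; [apply (Cmod_peval_le r); exact hw |].
        apply pnorm_trunc_le with rho; easy. }
      assert (hw2 : Rabs (w ^ (2 + n)) <= (rho / 2) ^ (2 + n)).
      { rewrite <- RPow_abs. apply pow_incr. split; [apply Rabs_pos | lra]. }
      assert (hprod : Cmod (RtoC (w ^ (2 + n)) * tail) <= 2 * B * (1 / 2) ^ n).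
      { rewrite Cmod_mult, Cmod_R.
        apply Rle_trans with ((rho / 2) ^ (2 + n) * (2 * (B / rho ^ (2 + n)))).
        - apply Rmult_le_compat; (apply Rabs_pos || apply Cmod_ge_0 || easy).
        - replace (rho / 2) with (rho * (1 / 2)) by field.
          rewrite Rpow_mult_distr, (pow_add (1 / 2)).
          pose proof (pow_lt rho (2 + n) hrho). pose proof (pow_lt (1 / 2) n ltac:(lra)).
          replace (rho ^ (2 + n) * ((1 / 2) ^ 2 * (1 / 2) ^ n) * (2 * (B / rho ^ (2 + n))))
            with (B * (1 / 2) ^ n / 2) by (field; lra).
          nra. }
      nra. }
  assert (e0 : c 0%nat = phi t0).
  { pose proof (l1ball_bound _ _ _ 0 (J 0 ltac:(lra)) ltac:(rewrite Rabs_R0; lra)) as h.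
    cbv beta in h. rewrite Rplus_0_r in h.
    replace (2 * (B / rho ^ 2) * 0 ^ 2) with 0 in h by (simpl; ring).
    pose proof (Cmod_ge_0 (phi t0 - c 0%nat - c 1%nat * RtoC 0)%C) as h'.
    assert (h0 : (phi t0 - c 0%nat - c 1%nat * RtoC 0)%C = RtoC 0)
      by (apply Cmod_eq_0; lra).
    replace (phi t0) with ((phi t0 - c 0%nat - c 1%nat * RtoC 0) + c 0%nat)%C by ring.
    rewrite h0. ring. }
  exists (c 1%nat), (2 * (B / rho ^ 2)), (rho / 2).
  split; [lra |]. split; [lra |]. split; [lra |]. split.
  - assert (0 <= B / rho ^ 2); [|lra].
    apply Rdiv_le_0_compat; [easy | apply pow_lt; easy].
  - intros r hr. rewrite <- e0. apply J; easy.
Qed.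

Lemma analytic_jet_bound (phi : R -> C) (t0 : R) (d : C) (K r0 w : R) :
  analytic_jet phi t0 d K r0 -> Rabs w <= r0 ->
  Cmod (phi (t0 + w) - phi t0 - d * w) <= K * w ^ 2.
Proof.
  intros hj hw. rewrite <- (pow2_abs w).
  apply (l1ball_bound (Rabs w) _ (fun w : R => phi (t0 + w)%R - phi t0 - d * w)%C);
    [|lra].
  apply hj. split; [apply Rabs_pos | easy].
Qed.

Lemma constant_of_quadratic (a b : R) (f : R -> R) :
  (forall t, a < t < b -> exists K r0, 0 < r0 /\
     forall w, Rabs w <= r0 -> Rabs (f (t + w) - f t) <= K * w ^ 2) ->
  forall t1 t2, a < t1 < b -> a < t2 < b -> f t1 = f t2.
Proof.
  intros H t1 t2 h1 h2.
  assert (hd : forall t, a < t < b -> is_derive f t 0).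
  { intros t ht. destruct (H t ht) as [K [r0 [hr0 hq]]].
    apply is_derive_Reals. intros eps he.
    set (K' := Rabs K + 1). assert (hK' : 0 < K') by (unfold K'; pose proof (Rabs_pos K); lra).
    assert (hdl : 0 < Rmin r0 (eps / K')).
    { apply Rmin_glb_lt; [easy | apply Rdiv_lt_0_compat; easy]. }
    exists (mkposreal _ hdl). intros w hw0 hw. simpl in hw.
    assert (hw1 : Rabs w < r0) by (eapply Rlt_le_trans; [exact hw | apply Rmin_l]).
    assert (hw2 : Rabs w < eps / K') by (eapply Rlt_le_trans; [exact hw | apply Rmin_r]).
    apply Rlt_div_r in hw2; [|easy].
    specialize (hq w ltac:(lra)). rewrite Rminus_0_r, Rabs_div by easy.
    pose proof (Rabs_pos_lt w hw0) as hp. apply Rlt_div_l; [easy |].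
    eapply Rle_lt_trans; [exact hq |]. rewrite <- (pow2_abs w).
    apply Rle_lt_trans with (Rabs w * K' * Rabs w); [|nra].
    pose proof (Rle_abs K). unfold K'. nra. }
  assert (hin : forall t, Rmin t1 t2 <= t <= Rmax t1 t2 -> a < t < b).
  { intros t. unfold Rmin, Rmax. destruct (Rle_dec t1 t2); lra. }
  destruct (MVT_gen f t1 t2 (fun _ => 0)) as [t [_ e]].
  - intros t ht. apply hd, hin. lra.
  - intros t ht. apply derivable_continuous_pt. exists 0.
    apply is_derive_Reals, hd, hin, ht.
  - lra.
Qed.

Lemma Cmod_sqr_minus_le (z w : C) :
  Rabs (Cmod z ^ 2 - Cmod w ^ 2) <= Cmod (z - w) * (Cmod (z - w) + 2 * Cmod w).
Proof.
  replace (Cmod z ^ 2 - Cmod w ^ 2) with ((Cmod z - Cmod w) * (Cmod z + Cmod w)) by ring.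
  pose proof (Cmod_ge_0 z). pose proof (Cmod_ge_0 w). pose proof (Cmod_ge_0 (z - w)).
  assert (h1 : Cmod z <= Cmod (z - w) + Cmod w).
  { replace z with ((z - w) + w)%C at 1 by ring. apply Cmod_triangle. }
  assert (h2 : Cmod w <= Cmod (z - w) + Cmod z).
  { rewrite Cmod_sym. replace w with ((w - z) + z)%C at 1 by ring. apply Cmod_triangle. }
  rewrite Rabs_mult, (Rabs_pos_eq (_ + _)) by lra.
  apply Rmult_le_compat; try lra; try apply Rabs_pos.
  apply Rabs_le. lra.
Qed.

(** If the derivative vanished wherever [phi] differs from [e], then so would
    the derivative of [|phi - e|^2] everywhere, and [phi] would be constant. *)
Lemma exists_regular_point (a b : R) (phi : R -> C) (e : C) :
  real_analytic a b phi -> non_constant a b phi ->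
  exists t0 d K r0, a < t0 - r0 /\ t0 + r0 < b /\ 0 < r0 /\ 0 <= K /\
    analytic_jet phi t0 d K r0 /\ d <> RtoC 0 /\ phi t0 <> e.
Proof.
  intros ha [t1 [t2 [h1 [h2 hne]]]]. apply NNPP. intros hc.
  assert (hz : forall t, a < t < b -> phi t <> e ->
    exists K r0, 0 < r0 /\ forall w, Rabs w <= r0 ->
      Cmod (phi (t + w)%R - phi t) <= K * w ^ 2).
  { intros t ht hte.
    destruct (real_analytic_jet a b phi t ha ht) as [d [K [r0 [hr0 [hr1 [hr2 [hK hj]]]]]]].
    exists K, r0. split; [easy |]. intros w hw.
    pose proof (analytic_jet_bound _ _ _ _ _ _ hj hw) as h.
    assert (hd : d = RtoC 0).
    { apply NNPP. intros hd. apply hc. exists t, d, K, r0. repeat split; easy. }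
    rewrite hd in h.
    replace (phi (t + w)%R - phi t)%C with (phi (t + w)%R - phi t - RtoC 0 * w)%C by ring.
    exact h. }
  assert (hu : forall t t', a < t < b -> a < t' < b ->
    Cmod (phi t - e) ^ 2 = Cmod (phi t' - e) ^ 2).
  { apply (constant_of_quadratic a b (fun t => Cmod (phi t - e) ^ 2)).
    intros t ht. destruct (classic (phi t = e)) as [hte | hte].
    - destruct (real_analytic_jet a b phi t ha ht)
        as [d [K [r0 [hr0 [hr1 [hr2 [hK hj]]]]]]].
      exists ((Cmod d + K * r0) ^ 2), r0. split; [easy |]. intros w hw.
      pose proof (analytic_jet_bound _ _ _ _ _ _ hj hw) as h.
      assert (h' : Cmod (phi (t + w)%R - e) <= (Cmod d + K * r0) * Rabs w).
      { replace (phi (t + w)%R - e)%C with ((phi (t + w)%R - phi t - d * w) + d * w)%C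
          by (rewrite hte; ring).
        eapply Rle_trans; [apply Cmod_triangle |]. rewrite Cmod_mult, Cmod_R.
        rewrite <- (pow2_abs w) in h. pose proof (Rabs_pos w).
        assert (Rabs w ^ 2 <= r0 * Rabs w) by nra.
        assert (K * Rabs w ^ 2 <= K * (r0 * Rabs w)) by (apply Rmult_le_compat_l; easy).
        lra. }
      rewrite hte. replace (e - e)%C with (RtoC 0) by ring. rewrite Cmod_0.
      replace (Cmod (phi (t + w)%R - e) ^ 2 - 0 ^ 2) with (Cmod (phi (t + w)%R - e) ^ 2)
        by (simpl; ring).
      rewrite Rabs_pos_eq by apply pow2_ge_0.
      rewrite <- (pow2_abs w), <- Rpow_mult_distr.
      apply pow_incr. split; [apply Cmod_ge_0 | exact h'].
    - destruct (hz t ht hte) as [K [r0 [hr0 hq]]].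
      exists (K * (Rabs K * r0 ^ 2 + 2 * Cmod (phi t - e))), r0.
      split; [easy |]. intros w hw. specialize (hq w hw).
      eapply Rle_trans; [apply Cmod_sqr_minus_le |].
      replace (phi (t + w)%R - e - (phi t - e))%C with (phi (t + w)%R - phi t)%C by ring.
      pose proof (Cmod_ge_0 (phi t - e)) as h0.
      pose proof (Cmod_ge_0 (phi (t + w)%R - phi t)) as h3.
      assert (hw2 : w ^ 2 <= r0 ^ 2).
      { rewrite <- (pow2_abs w). apply pow_incr. split; [apply Rabs_pos | easy]. }
      pose proof (pow2_ge_0 w) as hw3.
      assert (hq2 : K * w ^ 2 <= Rabs K * r0 ^ 2).
      { pose proof (Rle_abs K). pose proof (Rabs_pos K). nra. }
      replace (K * (Rabs K * r0 ^ 2 + 2 * Cmod (phi t - e)) * w ^ 2)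
        with (K * w ^ 2 * (Rabs K * r0 ^ 2 + 2 * Cmod (phi t - e))) by ring.
      apply Rmult_le_compat; lra. }
  destruct (classic (exists t, a < t < b /\ phi t = e)) as [[t [ht hte]] | hno].
  - apply hne.
    assert (hall : forall t', a < t' < b -> phi t' = e).
    { intros t' ht'. specialize (hu t' t ht' ht). rewrite hte in hu.
      replace (e - e)%C with (RtoC 0) in hu by ring. rewrite Cmod_0 in hu.
      assert (h0 : Cmod (phi t' - e) = 0).
      { pose proof (Cmod_ge_0 (phi t' - e)). simpl in hu. nra. }
      apply Cmod_eq_0 in h0.
      replace (phi t') with ((phi t' - e) + e)%C by ring. rewrite h0. ring. }
    rewrite !hall; easy.
  - assert (hz' : forall t, a < t < b -> exists K r0, 0 < r0 /\ forall w, Rabs w <= r0 ->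
      Cmod (phi (t + w)%R - phi t) <= K * w ^ 2).
    { intros t ht. apply hz; [easy |]. intros he. apply hno. now exists t. }
    apply hne. apply injective_projections.
    + apply (constant_of_quadratic a b (fun t => Re (phi t))); try easy.
      intros t ht. destruct (hz' t ht) as [K [r0 [hr0 hq]]]. exists K, r0.
      split; [easy |]. intros w hw. eapply Rle_trans; [|apply (hq w hw)].
      apply (re_le_Cmod (phi (t + w)%R - phi t)).
    + apply (constant_of_quadratic a b (fun t => Im (phi t))); try easy.
      intros t ht. destruct (hz' t ht) as [K [r0 [hr0 hq]]]. exists K, r0.
      split; [easy |]. intros w hw. eapply Rle_trans; [|apply (hq w hw)].
      apply (im_le_Cmod (phi (t + w)%R - phi t)).
Qed.

(** * Straightening and the contradiction *)

(** The derivative of the [n]-th iterate along a curve through [z] with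
    velocity [d]; since [f' = f] it is a product of orbit points. *)
Fixpoint iter_deriv (lam : R) (z d : C) (n : nat) : C :=
  match n with
  | O => d
  | S m => (iter (fexp lam) (S m) z * iter_deriv lam z d m)%C
  end.

Section Distortion.

Variables (lam beta : R) (phi : R -> C) (t0 : R) (d : C) (K r0 : R).
Hypothesis (hbeta : 1 < beta) (hd : d <> RtoC 0) (hK : 0 <= K)
  (hr0 : 0 < r0) (hjet : analytic_jet phi t0 d K r0)
  (hRe : forall n, beta <= Re (iter (fexp lam) n (phi t0))).

Let z n := iter (fexp lam) n (phi t0).
Let D n := iter_deriv lam (phi t0) d n.

Lemma Cmod_iter_deriv_S (n : nat) : Cmod (D (S n)) = Cmod (z (S n)) * Cmod (D n).
Proof. unfold D. simpl iter_deriv. rewrite Cmod_mult. reflexivity. Qed.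

Lemma Cmod_orbit_ge (n : nat) : beta <= Cmod (z n).
Proof. eapply Rle_trans; [apply hRe | apply Re_le_Cmod]. Qed.

Lemma Cmod_iter_deriv_ge (n : nat) : beta ^ n * Cmod d <= Cmod (D n).
Proof.
  induction n as [|n IH]; [unfold D; simpl; lra |].
  rewrite Cmod_iter_deriv_S. simpl pow. rewrite Rmult_assoc.
  apply Rmult_le_compat; try lra.
  - apply Rmult_le_pos; [apply pow_le; lra | apply Cmod_ge_0].
  - apply Cmod_orbit_ge.
Qed.

(** The distortion is governed by the last step alone: the lengths [|D_k| r]
    of the image arcs grow at least geometrically, so the sum of the earlier
    ones is absorbed by [exp (b l)] with [l] the last of them, the constant [b]
    being the one for which [b + 2 = b beta]. *)
Lemma distortion_step (r kappa : R) (n : nat) :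
  let b := 2 / (beta - 1) in
  0 < r <= r0 -> K * r <= kappa * Cmod d ->
  (1 + kappa) * exp (b * (Cmod (D n) * r)) <= 2 ->
  (exists q, 0 <= q /\
     l1ball r q (fun w : R => iter (fexp lam) n (phi (t0 + w)%R) - z n - D n * w)%C /\
     Cmod (D n) * r + q <= (1 + kappa) * (Cmod (D n) * r) * exp (b * (Cmod (D n) * r)))
  /\
  (exists q, 0 <= q /\
     l1ball r q (fun w : R =>
       iter (fexp lam) (S n) (phi (t0 + w)%R) - z (S n) - D (S n) * w)%C /\
     Cmod (D (S n)) * r + q
       <= (1 + kappa) * (Cmod (D (S n)) * r) * exp ((b + 2) * (Cmod (D n) * r))).
Proof.
  intros b hr hkap.
  assert (hb : 0 < b) by (unfold b; apply Rdiv_lt_0_compat; lra).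
  assert (hbb : b + 2 = b * beta) by (unfold b; field; lra).
  pose proof (proj1 (Cmod_gt_0 d) hd) as hd0.
  assert (hkap0 : 0 <= kappa) by (assert (0 <= K * r) by nra; nra).
  assert (step : forall n, (1 + kappa) * exp (b * (Cmod (D n) * r)) <= 2 ->
    (exists q, 0 <= q /\
     l1ball r q (fun w : R => iter (fexp lam) n (phi (t0 + w)%R) - z n - D n * w)%C /\
     Cmod (D n) * r + q <= (1 + kappa) * (Cmod (D n) * r) * exp (b * (Cmod (D n) * r)))
    -> exists q, 0 <= q /\
     l1ball r q (fun w : R =>
       iter (fexp lam) (S n) (phi (t0 + w)%R) - z (S n) - D (S n) * w)%C /\
     Cmod (D (S n)) * r + q
       <= (1 + kappa) * (Cmod (D (S n)) * r) * exp ((b + 2) * (Cmod (D n) * r))).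
  { clear n. intros n h2 [q [hq [hball hN]]].
    pose proof (Cmod_ge_0 (D n)) as hD. pose proof (Cmod_orbit_ge (S n)) as hz.
    set (l := Cmod (D n) * r) in *. set (N := l + q) in *.
    assert (hl : 0 <= l) by (unfold l; nra).
    set (m := Cmod (z (S n))) in *.
    exists (m * (q + (exp N - 1 - N))).
    pose proof (exp_ineq1_le N) as he1. pose proof (exp_minus_1_le N) as he2.
    split; [apply Rmult_le_pos; lra |]. split.
    - apply (l1ball_fexp_affine lam r q (z n) (D n)
        (fun w => iter (fexp lam) n (phi (t0 + w)%R))); [lra | exact hball].
    - rewrite Cmod_iter_deriv_S. fold m.
      assert (hN2 : N <= 2 * l) by nra.
      assert (heN : exp N <= exp (2 * l)) by (apply exp_le_mono; easy).
      pose proof (exp_pos N) as hp. pose proof (exp_pos (b * l)).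
      replace (m * Cmod (D n) * r) with (m * l) by (unfold l; ring).
      apply Rle_trans with (m * (N * exp N)).
      { replace q with (N - l) by (unfold N; ring).
        apply Rle_trans with (m * (exp N - 1)); [right; ring |].
        apply Rmult_le_compat_l; lra. }
      apply Rle_trans with
        (m * ((1 + kappa) * l * exp (b * l) * exp (2 * l))).
      { apply Rmult_le_compat_l; [lra |].
        apply Rmult_le_compat; try lra. unfold N; lra. }
      right. replace ((b + 2) * l) with (b * l + 2 * l) by ring.
      rewrite exp_plus. ring. }
  intros h2.
  assert (H : exists q, 0 <= q /\
     l1ball r q (fun w : R => iter (fexp lam) n (phi (t0 + w)%R) - z n - D n * w)%C /\
     Cmod (D n) * r + q
       <= (1 + kappa) * (Cmod (D n) * r) * exp (b * (Cmod (D n) * r))).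
  { induction n as [|n IH].
    - exists (K * r ^ 2). split; [pose proof (pow2_ge_0 r); nra |]. split.
      + apply (hjet r). lra.
      + unfold D. simpl iter_deriv.
        assert (1 <= exp (b * (Cmod d * r))).
        { rewrite <- exp_0. apply exp_le_mono. apply Rmult_le_pos; nra. }
        apply Rle_trans with ((1 + kappa) * (Cmod d * r)).
        * nra.
        * assert (0 <= (1 + kappa) * (Cmod d * r)); [|nra].
          apply Rmult_le_pos; nra.
    - assert (hll : beta * (Cmod (D n) * r) <= Cmod (D (S n)) * r).
      { rewrite Cmod_iter_deriv_S. pose proof (Cmod_orbit_ge (S n)).
        pose proof (Cmod_ge_0 (D n)). rewrite Rmult_assoc.
        apply Rmult_le_compat_r; [nra | easy]. }
      assert (hl0 : 0 <= Cmod (D n) * r) by (pose proof (Cmod_ge_0 (D n)); nra).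
      assert (h2n : (1 + kappa) * exp (b * (Cmod (D n) * r)) <= 2).
      { eapply Rle_trans; [|exact h2]. apply Rmult_le_compat_l; [lra |].
        apply exp_le_mono. apply Rmult_le_compat_l; nra. }
      destruct (step n h2n (IH h2n)) as [q [hq [hball hN]]].
      exists q. split; [easy |]. split; [easy |].
      eapply Rle_trans; [exact hN |].
      apply Rmult_le_compat_l.
      + apply Rmult_le_pos; [lra |]. pose proof (Cmod_ge_0 (D (S n))). nra.
      + apply exp_le_mono. rewrite hbb, Rmult_assoc. apply Rmult_le_compat_l; lra. }
  split; [exact H | apply step; easy].
Qed.

Hypothesis (hesc : escaping lam (phi t0)).

(** Along an escaping orbit [distortion_step] loses nothing in the limit, since
    the last but one arc has length [R0 / |z_n|]: the image of the curve is
    within 1 of a straight line of any prescribed length [R0]. *)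
Lemma linearization (R0 : R) : 1 <= R0 ->
  exists N, forall n, (N <= n)%nat -> exists r, 0 < r <= r0 /\
    Cmod (D n) * r = R0 /\
    l1ball r 1 (fun w : R => iter (fexp lam) n (phi (t0 + w)%R) - z n - D n * w)%C.
Proof.
  intros hR. set (b := 2 / (beta - 1)).
  assert (hb : 0 < b) by (unfold b; apply Rdiv_lt_0_compat; lra).
  pose proof (proj1 (Cmod_gt_0 d) hd) as hd0.
  destruct (hesc ((b + 2) * (4 * R0 ^ 2))) as [N1 hN1].
  destruct (pow_large beta (R0 / (Cmod d * r0)) hbeta) as [N2 hN2].
  destruct (pow_large beta (4 * R0 ^ 2 * K / (Cmod d * Cmod d)) hbeta) as [N3 hN3].
  exists (S (N1 + N2 + N3)). intros n hn.
  pose proof (Cmod_iter_deriv_ge n) as hDn.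
  specialize (hN2 n ltac:(lia)). specialize (hN3 n ltac:(lia)).
  apply Rle_div_l in hN2; [|nra]. apply Rle_div_l in hN3; [|nra].
  assert (hbn : 0 < beta ^ n) by (apply pow_lt; lra).
  assert (hD0 : 0 < Cmod (D n)) by nra.
  set (r := R0 / Cmod (D n)).
  assert (hDr : Cmod (D n) * r = R0) by (unfold r; field; lra).
  assert (hr : 0 < r) by (unfold r; apply Rdiv_lt_0_compat; lra).
  assert (hrr : r <= r0) by nra.
  exists r. split; [lra |]. split; [exact hDr |].
  destruct n as [|p]; [lia |].
  specialize (hN1 (S p) ltac:(lia)). fold (z (S p)) in hN1.
  pose proof (Re_le_Cmod (z (S p))) as hz.
  set (m := Cmod (z (S p))) in *. rewrite Cmod_iter_deriv_S in hDr. fold m in hDr.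
  set (l := Cmod (D p) * r).
  assert (hml : m * l = R0) by (unfold l; lra).
  assert (hl : 0 <= l) by (unfold l; pose proof (Cmod_ge_0 (D p)); nra).
  set (x := 1 / (4 * R0)).
  assert (hx : x * (4 * R0) = 1) by (unfold x; field; lra).
  assert (hx0 : 0 < x) by (unfold x; apply Rdiv_lt_0_compat; lra).
  assert (hlx : (b + 2) * l <= x).
  { assert ((b + 2) * (4 * R0 ^ 2) * l <= R0).
    { apply Rle_trans with (m * l); [|lra]. apply Rmult_le_compat_r; lra. }
    apply Rmult_le_reg_r with (4 * R0 ^ 2); [nra |].
    replace (x * (4 * R0 ^ 2)) with (x * (4 * R0) * R0) by ring. rewrite hx. lra. }
  assert (hkap : K * r <= x * Cmod d).
  { apply Rmult_le_reg_r with (4 * R0 * Cmod d * beta ^ S p).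
    { apply Rmult_lt_0_compat; [nra | exact hbn]. }
    replace (x * Cmod d * (4 * R0 * Cmod d * beta ^ S p))
      with (x * (4 * R0) * (beta ^ S p * (Cmod d * Cmod d))) by ring.
    rewrite hx, Rmult_1_l. eapply Rle_trans; [|exact hN3].
    replace (K * r * (4 * R0 * Cmod d * beta ^ S p))
      with (4 * R0 * K * (beta ^ S p * Cmod d * r)) by ring.
    replace (4 * R0 ^ 2 * K) with (4 * R0 * K * (m * Cmod (D p) * r))
      by (rewrite hDr; ring).
    apply Rmult_le_compat_l; [nra |].
    apply Rmult_le_compat_r; [lra |].
    rewrite Cmod_iter_deriv_S in hDn. exact hDn. }
  assert (hx14 : x <= 1 / 4) by nra.
  assert (hexp : (1 + x) * exp ((b + 2) * l) <= 1 + 1 / R0).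
  { assert (h4 : 1 / R0 = 4 * x) by (unfold x; field; lra). rewrite h4.
    assert (he : exp ((b + 2) * l) <= exp x) by (apply exp_le_mono; easy).
    assert (he' : exp x * (1 - x) <= 1).
    { pose proof (exp_minus_1_le x). lra. }
    pose proof (exp_pos x). nra. }
  assert (h1R : 1 / R0 <= 1) by (apply Rle_div_l; lra).
  assert (hR1 : R0 * (1 / R0) = 1) by (field; lra).
  destruct (distortion_step r x p) as [_ [q [hq [hball hN]]]].
  - lra.
  - exact hkap.
  - fold b. fold l. eapply Rle_trans; [|apply Rle_trans with (1 := hexp); lra].
    apply Rmult_le_compat_l; [lra |]. apply exp_le_mono. nra.
  - apply l1ball_mono with q; [|exact hball].
    fold b in hN. fold l in hN. rewrite Cmod_iter_deriv_S in hN. fold m in hN.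
    rewrite hDr in hN. nra.
Qed.

End Distortion.

(** The left-hand side is what extrapolation from [n] far nodes gives for the
    offset at the base point, and [exp (- X)] is a lower bound for that offset.
    Taking [n] close to [X] makes the remainder [exp (- 8 n)] beat both the
    extrapolation constant [exp (4 n)] and the bound itself. *)
Lemma extrapolation_contradiction (X M A n : R) :
  1 <= X -> X <= n <= X + 1 -> 0 <= A -> 0 <= M <= A * X ->
  exp 4 + 2 * A < X ->
  exp (4 * n) * (exp (- (6 * X)) + 2 * (exp (- (8 * n)) * M)) < exp (- X).
Proof.
  intros hX hn hA hM hlarge.
  assert (e1 : exp (4 * n) * exp (- (6 * X)) <= exp 4 * exp (- (2 * X))).
  { rewrite <- !exp_plus. apply exp_le_mono. lra. }
  assert (e2 : exp (4 * n) * exp (- (8 * n)) <= exp (- (4 * X))).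
  { rewrite <- exp_plus. apply exp_le_mono. lra. }
  assert (e3 : exp (- (4 * X)) * X <= exp (- (2 * X))).
  { replace (- (2 * X)) with (- (4 * X) + (X + X)) by ring.
    rewrite !exp_plus. pose proof (exp_ineq1_le X). pose proof (exp_pos (- (4 * X))).
    apply Rmult_le_compat_l; [lra |]. nra. }
  assert (e4 : exp (- X) = exp (- (2 * X)) * exp X).
  { rewrite <- exp_plus. f_equal. ring. }
  pose proof (exp_ineq1_le X). pose proof (exp_pos (- (2 * X))) as hp.
  pose proof (exp_pos (- (4 * X))) as hp4. rewrite e4.
  assert (e5 : exp (4 * n) * exp (- (8 * n)) * M <= A * exp (- (2 * X))).
  { apply Rle_trans with (exp (- (4 * X)) * M).
    - apply Rmult_le_compat_r; lra.
    - apply Rle_trans with (exp (- (4 * X)) * (A * X)).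
      + apply Rmult_le_compat_l; lra.
      + nra. }
  nra.
Qed.

Lemma Im_minus (a b : C) : Im (a - b) = Im a - Im b.
Proof. reflexivity. Qed.

Lemma Re_minus (a b : C) : Re (a - b) = Re a - Re b.
Proof. reflexivity. Qed.

(** A displacement that is long and nearly affine, but whose imaginary part is
    bounded by the width of the strip, is nearly horizontal. *)
Lemma Re_displacement_ge (a b v : C) :
  Rabs (Im b - Im a) <= 8 -> Cmod (b - a - v) <= 1 -> 14 <= Cmod v -> 0 <= Re v ->
  4 <= Re b - Re a.
Proof.
  intros hI h1 hv hr.
  pose proof (im_le_Cmod (b - a - v)) as hi. rewrite !Im_minus in hi.
  pose proof (re_le_Cmod (b - a - v)) as hre. rewrite !Re_minus in hre.
  pose proof (Cmod_le_abs v) as h. rewrite (Rabs_pos_eq (Re v)) in h by easy.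
  assert (Rabs (Im v) <= 9).
  { replace (Im v) with ((Im b - Im a) - (Im b - Im a - Im v)) by ring.
    eapply Rle_trans; [apply Rabs_triang |]. rewrite Rabs_Ropp. lra. }
  assert (hre' : Rabs (Re b - Re a - Re v) <= 1) by lra.
  apply Rabs_le_between in hre'. lra.
Qed.

(** The offset of [z] in its strip is about [|Im (f z)| / |f z|].  Moving 4 units
    to the right along the hair at time [n] multiplies the modulus at time
    [n + 1] by at least 16, while the imaginary parts at time [n + 2] change by
    at most [2 PI]; so the offset at time [n + 1] drops from about [exp (- X)]
    to less than [exp (- 6 X)]. *)
Lemma far_offset_le (lam beta : R) (s : nat -> Z) (z0 z1 : C) (n : nat) :
  0 < lam <= 1 -> 1 < beta -> itinerary lam beta s z0 -> itinerary lam beta s z1 ->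
  4 <= Re (iter (fexp lam) n z1) - Re (iter (fexp lam) n z0) ->
  let X := Cmod (iter (fexp lam) (S n) z0) in
  2 <= X -> 18 / lam <= X ->
  Rabs (Im (iter (fexp lam) (S n) z1) - 2 * IZR (s (S n)) * PI) <= exp (- (6 * X)).
Proof.
  intros hl hb h0 h1 hgap X hX2 hXl.
  assert (hImd : forall k,
    Rabs (Im (iter (fexp lam) k z1)) <= Rabs (Im (iter (fexp lam) k z0)) + 8).
  { intros k. pose proof (strip_Im_minus _ _ _ (proj2 (h1 k)) (proj2 (h0 k))).
    pose proof PI_4.
    replace (Im (iter (fexp lam) k z1))
      with (Im (iter (fexp lam) k z0)
            + (Im (iter (fexp lam) k z1) - Im (iter (fexp lam) k z0))) by ring.
    eapply Rle_trans; [apply Rabs_triang |]. lra. }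
  set (v0 := iter (fexp lam) (S n) z0) in *. set (v1 := iter (fexp lam) (S n) z1) in *.
  assert (hv : 16 * X <= Cmod v1).
  { unfold X, v0, v1. rewrite !iter_S, !Cmod_fexp by lra.
    set (a := Re (iter (fexp lam) n z0)) in *. set (b := Re (iter (fexp lam) n z1)) in *.
    assert (16 <= exp (b - a)).
    { apply exp_ge_16. lra. }
    replace b with ((b - a) + a) by ring. rewrite exp_plus.
    pose proof (exp_pos a).
    replace (16 * (lam * exp a)) with (lam * (16 * exp a)) by ring.
    apply Rmult_le_compat_l; [lra |]. apply Rmult_le_compat_r; lra. }
  assert (hRev : 8 * X <= Re v1).
  { pose proof (Cmod_le_abs v1) as h. pose proof (hImd (S n)) as hi. fold v0 v1 in hi.
    pose proof (im_le_Cmod v0) as hi0. fold X in hi0.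
    pose proof (proj1 (h1 (S n))) as hre. fold v1 in hre.
    rewrite (Rabs_pos_eq (Re v1)) in h by lra. lra. }
  pose proof (hImd (S (S n))) as hImu. rewrite !iter_S with (n := S n) in hImu.
  fold v0 v1 in hImu.
  pose proof (proj1 (h1 (S (S n)))) as hReu. rewrite iter_S in hReu. fold v1 in hReu.
  assert (hu0 : Rabs (Im (fexp lam v0)) <= exp X).
  { eapply Rle_trans; [apply im_le_Cmod |]. rewrite Cmod_fexp by lra.
    assert (exp (Re v0) <= exp X) by (apply exp_le_mono, Re_le_Cmod).
    pose proof (exp_pos (Re v0)). nra. }
  assert (hu1 : lam * exp (8 * X) <= Cmod (fexp lam v1)).
  { rewrite Cmod_fexp by lra. apply Rmult_le_compat_l; [lra |].
    apply exp_le_mono; easy. }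
  pose proof (Cmod_le_abs (fexp lam v1)) as hC.
  rewrite (Rabs_pos_eq (Re (fexp lam v1))) in hC by lra.
  pose proof (strip_offset_le lam _ _ (proj1 hl) (proj2 (h1 (S n))) ltac:(fold v1; lra))
    as hoff. fold v1 in hoff.
  set (y := Rabs (Im v1 - 2 * IZR (s (S n)) * PI)) in *.
  set (E := exp X) in *.
  assert (hE : 1 + X <= E) by apply exp_ineq1_le.
  assert (e8 : exp (8 * X) = exp (6 * X) * (E * E)).
  { unfold E. rewrite <- !exp_plus. f_equal. ring. }
  assert (h6 : 1 <= exp (6 * X)).
  { rewrite <- exp_0. apply exp_le_mono. lra. }
  rewrite exp_Ropp. set (G := exp (6 * X)) in *.
  assert (hlE : 18 <= lam * E).
  { apply Rle_div_l in hXl; [|lra]. nra. }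
  assert (hRe6 : G * (E + 8) <= Re (fexp lam v1)).
  { assert (18 * E <= lam * (E * E)) by nra.
    assert (G * (18 * E) <= lam * exp (8 * X)).
    { rewrite e8. replace (lam * (G * (E * E))) with (G * (lam * (E * E))) by ring.
      apply Rmult_le_compat_l; lra. }
    nra. }
  assert (hy0 : 0 <= y) by apply Rabs_pos.
  apply Rmult_le_reg_r with (G * (E + 8)); [nra |].
  replace (/ G * (G * (E + 8))) with (E + 8) by (field; lra).
  apply Rle_trans with (y * Re (fexp lam v1)).
  - apply Rmult_le_compat_l; easy.
  - lra.
Qed.

(** This is where non-triviality enters: outside the strip of index 0 the
    imaginary part of the next point is at least [PI], so the offset cannot be
    smaller than [PI] divided by the modulus of the next point. *)
Lemma near_offset_ge (lam beta : R) (s : nat -> Z) (z0 : C) (n : nat) :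
  0 < lam <= 1 -> 1 < beta -> itinerary lam beta s z0 -> s (S n) <> 0%Z ->
  exp (- Cmod (iter (fexp lam) n z0))
    <= Rabs (Im (iter (fexp lam) n z0) - 2 * IZR (s n) * PI).
Proof.
  intros hl hb h0 hs.
  pose proof (strip_Im_ge_PI _ _ hs (proj2 (h0 (S n)))) as hI.
  pose proof (proj1 (h0 (S n))) as hR. rewrite iter_S in hI, hR.
  pose proof (strip_offset_ge lam _ _ (proj1 hl) (proj2 (h0 n)) ltac:(lra)) as h.
  set (v := iter (fexp lam) n z0) in *.
  rewrite exp_Ropp. set (y := Rabs (Im v - 2 * IZR (s n) * PI)) in *.
  assert (hu : Cmod (fexp lam v) <= exp (Cmod v)).
  { rewrite Cmod_fexp by lra.
    assert (exp (Re v) <= exp (Cmod v)) by (apply exp_le_mono, Re_le_Cmod).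
    pose proof (exp_pos (Re v)). nra. }
  pose proof PI2_3_2. assert (hy0 : 0 <= y) by apply Rabs_pos.
  pose proof (exp_pos (Cmod v)).
  apply Rmult_le_reg_r with (exp (Cmod v)); [easy |].
  rewrite Rinv_l by lra. nra.
Qed.

(** At a late time [n] with [s (n + 2)] not 0, the offset [Im (g w)] of the
    curve in its strip at time [n + 1] has an analytic radius [r] over which
    the curve at time [n] runs through the length [R0] on either side.  It is tiny at the nodes
    [j h], hence too small at 0. *)
Lemma no_analytic_arc (lam beta : R) (s : nat -> Z) (phi : R -> C) (t0 : R)
    (d : C) (K r0 : R) :
  0 < lam <= 1 -> 1 < beta -> d <> RtoC 0 -> 0 <= K -> 0 < r0 ->
  analytic_jet phi t0 d K r0 ->
  (forall w, Rabs w <= r0 -> itinerary lam beta s (phi (t0 + w))) ->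
  escaping lam (phi t0) ->
  (forall n, exists m, (n <= m)%nat /\ s m <> 0%Z) -> False.
Proof.
  intros hl hb hd hK hr0 hj hit hesc hs.
  assert (h0 : itinerary lam beta s (phi t0)).
  { replace t0 with (t0 + 0) by ring. apply hit. rewrite Rabs_R0. lra. }
  (* The nodes lie within [exp (- 8) r] of 0 and beyond half of that, so at time
     [n] they are at distance at least 14 from the base point. *)
  set (R0 := 28 * exp 8).
  assert (hR0 : 1 <= R0) by (unfold R0; pose proof (exp_ineq1_le 8); lra).
  destruct (linearization lam beta phi t0 d K r0 hb hd hK hr0 hj
    (fun n => proj1 (h0 n)) hesc R0 hR0) as [N1 hN1].
  set (A := exp (R0 + 1) + 5).
  assert (hA : 0 < A) by (unfold A; pose proof (exp_pos (R0 + 1)); lra).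
  destruct (hesc (exp 4 + 2 * A + 18 / lam + 1)) as [N2 hN2].
  destruct (hs (N1 + N2 + 2)%nat) as [m [hm hsm]].
  destruct m as [|[|n]]; [lia | lia |].
  destruct (hN1 n ltac:(lia)) as [r [hr [hDr hball]]].
  set (z0 := phi t0) in *.
  set (D := iter_deriv lam z0 d n) in *.
  specialize (hN2 (S n) ltac:(lia)).
  set (v0 := iter (fexp lam) (S n) z0) in *.
  set (X := Cmod v0).
  pose proof (Re_le_Cmod v0) as hXR. fold X in hXR.
  assert (h18 : 0 < 18 / lam) by (apply Rdiv_lt_0_compat; lra).
  pose proof (exp_ineq1_le 4) as he4.
  destruct (nfloor_ex X ltac:(lra)) as [N' hN'].
  set (N := S N'). assert (hNX : X <= INR N <= X + 1) by (unfold N; rewrite S_INR; lra).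
  assert (hNpos : 0 < INR N) by lra.
  set (theta := exp (- 8)).
  assert (hth : 0 < theta <= 1).
  { unfold theta. split; [apply exp_pos |]. rewrite <- exp_0.
    apply exp_le_mono; lra. }
  assert (hthR : theta * R0 = 28).
  { unfold theta, R0. replace (exp (-8) * (28 * exp 8)) with (28 * (exp (-8) * exp 8)) by ring.
    rewrite <- exp_plus. replace (-8 + 8) with 0 by ring. rewrite exp_0; ring. }
  (* The sign of the step is chosen such that the nodes lie to the right. *)
  set (h := (if Rle_dec 0 (Re D) then 1 else -1) * (theta * r / (2 * INR N))).
  assert (hhabs : Rabs h = theta * r / (2 * INR N)).
  { assert (hq : 0 <= theta * r / (2 * INR N)).
    { apply Rdiv_le_0_compat; nra. }
    unfold h. rewrite Rabs_mult, (Rabs_pos_eq (theta * r / (2 * INR N))) by easy.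
    destruct (Rle_dec 0 (Re D)); unfold Rabs; destruct (Rcase_abs _); lra. }
  assert (hDh : 0 <= Re D * h).
  { assert (hq : 0 <= theta * r / (2 * INR N)).
    { apply Rdiv_le_0_compat; nra. }
    unfold h. destruct (Rle_dec 0 (Re D)); nra. }
  assert (h2N : 2 * INR N * Rabs h = theta * r) by (rewrite hhabs; field; lra).
  set (c := (0, 2 * IZR (s (S n)) * PI) : C).
  set (g := fun w : R => (iter (fexp lam) (S n) (phi (t0 + w)%R) - c)%C).
  set (M := X * exp (R0 + 1) + (X + 4)).
  assert (hg : l1ball r M g).
  { unfold g, M. apply (l1ball_ext r _ (fun w : R =>
      fexp lam (iter (fexp lam) n (phi (t0 + w)%R)) + (- c))%C); [intros; reflexivity |].
    apply l1ball_plus; [lra | |].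
    - unfold X, v0. rewrite iter_S. apply l1ball_fexp; [lra |].
      apply l1ball_ext with (fun w : R => D * w
        + (iter (fexp lam) n (phi (t0 + w)%R) - iter (fexp lam) n z0 - D * w))%C;
        [intros; ring |].
      apply l1ball_plus; [lra | | exact hball].
      rewrite <- hDr. apply l1ball_linear.
    - apply l1ball_mono with (Cmod (- c)); [|apply l1ball_const].
      rewrite Cmod_opp. eapply Rle_trans; [apply Cmod_le_abs |].
      unfold c. simpl. rewrite Rabs_R0, Rplus_0_l.
      pose proof (proj2 (h0 (S n))) as hst. fold v0 in hst. unfold strip in hst.
      pose proof (im_le_Cmod v0) as hi. fold X in hi.
      apply Rabs_le_between in hi. pose proof PI_4. apply Rabs_le. lra. }
  assert (hfar : forall j, (N < j <= 2 * N)%nat ->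
    Rabs (Im (g (INR j * h))) <= exp (- (6 * X))).
  { intros j hjN.
    assert (hjR : INR N <= INR j <= 2 * INR N).
    { split; [apply le_INR; lia |]. replace 2 with (INR 2) by reflexivity.
      rewrite <- mult_INR. apply le_INR; lia. }
    set (w := INR j * h).
    assert (hwabs : Rabs w = INR j * Rabs h).
    { unfold w. rewrite Rabs_mult, Rabs_pos_eq; [easy | apply pos_INR]. }
    pose proof (Rabs_pos h) as hh0.
    assert (hw1 : theta * r <= 2 * Rabs w) by (rewrite hwabs; nra).
    assert (hw2 : Rabs w <= theta * r) by (rewrite hwabs; nra).
    assert (hw3 : Rabs w <= r) by nra.
    assert (h1 : itinerary lam beta s (phi (t0 + w))) by (apply hit; lra).
    replace (Im (g w)) with
      (Im (iter (fexp lam) (S n) (phi (t0 + w))) - 2 * IZR (s (S n)) * PI)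
      by reflexivity.
    apply (far_offset_le lam beta s z0 (phi (t0 + w)) n); try easy;
      try (fold v0; fold X; lra).
    apply (Re_displacement_ge _ _ (D * w)%C).
    - pose proof (strip_Im_minus _ _ _ (proj2 (h1 n)) (proj2 (h0 n))).
      pose proof PI_4. lra.
    - exact (l1ball_bound _ _ _ w hball hw3).
    - rewrite Cmod_mult, Cmod_R.
      apply Rmult_le_reg_l with 2; [lra |].
      apply Rle_trans with (theta * (Cmod D * r)).
      + rewrite hDr, hthR. lra.
      + pose proof (Cmod_ge_0 D). nra.
    - replace (Re (D * w)%C) with (INR j * (Re D * h)).
      + apply Rmult_le_pos; [apply pos_INR | easy].
      + unfold w, Re, Cmult, RtoC. simpl. ring. }
  pose proof (extrapolation N r M h theta (exp (- (6 * X))) g (proj1 hr)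
    (conj (Rlt_le _ _ (proj1 hth)) (proj2 hth)) (Req_le _ _ h2N)
    (Rlt_le _ _ (exp_pos _)) hg hfar) as hex.
  pose proof (near_offset_ge lam beta s z0 (S n) hl hb h0 hsm) as hnear.
  fold v0 in hnear. fold X in hnear.
  replace (Im (g 0)) with (Im v0 - 2 * IZR (s (S n)) * PI) in hex
    by (unfold g; rewrite Rplus_0_r; reflexivity).
  replace (theta ^ N) with (exp (- (8 * INR N))) in hex
    by (unfold theta; rewrite <- exp_INR_mult; f_equal; ring).
  pose proof (exp_pos (R0 + 1)) as hpos.
  pose proof (extrapolation_contradiction X M A (INR N)
    ltac:(lra) hNX ltac:(lra) ltac:(unfold M, A; nra) ltac:(lra)).
  lra.
Qed.

Theorem theorem1 (lam : R) (hlam : 0 < lam < / exp 1)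
    (s : nat -> Z) (hne : exists z : C, hair lam s z)
    (hnt : ~ trivial_hair lam s) :
  ~ exists (eps : R) (phi : R -> C),
      0 < eps /\
      real_analytic (- eps) eps phi /\
      non_constant (- eps) eps phi /\
      (forall t : R, - eps < t < eps -> hair lam s (phi t)).
Proof.
  intros [eps [phi [heps [han [hnc hin]]]]].
  destruct (exists_repelling lam hlam) as [beta [hb hfb]].
  assert (hit : forall t, - eps < t < eps -> itinerary lam beta s (phi t)).
  { intros t ht. apply itinerary_of_hair; auto. }
  assert (He : exists e, forall t, - eps < t < eps -> phi t <> e -> escaping lam (phi t)).
  { destruct (classic (exists t, - eps < t < eps /\ ~ escaping lam (phi t)))
      as [[t1 [ht1 hne1]] | hno].
    - exists (phi t1). intros t ht hdiff.
      destruct (escaping_or lam beta s (phi t) (phi t1)); auto; [lra | contradiction].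
    - exists (RtoC 0). intros t ht _. apply NNPP. intros h. apply hno. now exists t. }
  (* [e] is the only point of the curve that may fail to escape. *)
  destruct He as [e he].
  destruct (exists_regular_point (- eps) eps phi e han hnc)
    as [t0 [d [K [r0 [hr1 [hr2 [hr0 [hK [hj [hd hdiff]]]]]]]]]].
  pose proof (lam_exp1_lt_1 lam hlam). pose proof (exp_ineq1_le 1).
  apply (no_analytic_arc lam beta s phi t0 d K r0); auto.
  - nra.
  - intros w hw. apply Rabs_le_between in hw. apply hit. lra.
  - apply he; [lra | easy].
  - now apply (nontrivial_address lam beta).
Qed.
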